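(* Let $\mathcal S$ be a subgroup of the Clifford group on $\mathcal H_M$ containing the Pauli group and satisfying $|\{C\in\mathcal S:C^\dagger PC=Q\}|=|\mathcal S|/(4^{|M|}-1)$ for all non-identity Paulis $P,Q$. Let $(\mathrm{Enc}^{NM},\mathrm{Dec}^{NM})$ be a classical 2-split-state non-malleable code with perfect correctness whose messages are the elements $r\in\mathcal S$, outputting shares $(X,Y)$, which is augmented at share $X$ with error $\varepsilon_{NM}$. Define $\mathrm{Enc}(\sigma_M)=\mathbb E_{r\leftarrow\mathcal S}\big[\mathrm{Enc}^{NM}(r)_{XY}\otimes(r\,\sigma_M r^\dagger)_Z\big]$ with the two shares being $Y$ and $(X,Z)$, and $\mathrm{Dec}$: measure $X',Y'$, compute $r'=\mathrm{Dec}^{NM}(X',Y')$, apply $r'^\dagger$ to $Z'$ and output it. Then $(\mathrm{Enc},\mathrm{Dec})$ is an average-case quantum non-malleable code against $\mathsf{LO}^2$ with error at most $\varepsilon_{NM}+2^{2-|M|}$.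
   Context: A classical 2-split-state code: randomized $\mathrm{Enc}^{NM}$ from a finite message set to pairs of strings $(X,Y)$, and deterministic $\mathrm{Dec}^{NM}$. It is augmented at share $X$ with error $\varepsilon$ if for every pair of functions $(f,g)$ there exist $p_{f,g}\in[0,1]$, a distribution $\mathcal X_{f,g}$ on values of $X$ and a distribution $\mathcal D_{f,g}$ on (message, $X$-value) pairs, depending only on $(f,g)$, such that for every message $m$, with $(X,Y)\leftarrow\mathrm{Enc}^{NM}(m)$ and $m'=\mathrm{Dec}^{NM}(f(X),g(Y))$, the pair $(m',X)$ is within statistical distance $\varepsilon$ of $p_{f,g}(m,\mathcal X_{f,g})+(1-p_{f,g})\mathcal D_{f,g}$. $\mathsf{LO}^2$: channels $U\otimes V$ with $U$ CPTP on share $(X,Z)$ and $V$ CPTP on share $Y$. Average-case $\varepsilon$-secure quantum non-malleable code against $\mathsf{LO}^2$: for every adversary there exist $p\in[0,1]$ and a state $\gamma_{M'}$ depending only on the adversary such that, for $\sigma_{M\hat M}$ the maximally entangled state (canonical purification of the maximally mixed $U_M$), the output $\eta_{M'\hat M}=(\mathrm{Dec}\circ(U\otimes V)\circ\mathrm{Enc}\otimes\mathrm{id})(\sigma_{M\hat M})$ satisfies $\|\eta_{M'\hat M}-(p\sigma_{M\hat M}+(1-p)\gamma_{M'}\otimes U_{\hat M})\|_1\le\varepsilon$.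
   Formalization: Statistical distance is taken as the full l1 distance (no factor 1/2), matching the trace norm; with the halved distance the stated bound fails. Also, C†PC = Q is read up to a global phase, since exact equality for Pauli strings is inconsistent with S containing the Pauli group. *)

(* Defs.v *)
From HB Require Import structures.
From mathcomp Require Import all_boot all_order all_algebra.
From mathcomp Require Import boolp classical_sets reals.
From mathcomp Require Import complex mxtens.

Set Implicit Arguments.
Unset Strict Implicit.
Unset Printing Implicit Defensive.

Import Order.TTheory GRing.Theory Num.Theory.
Local Open Scope ring_scope.

(* Registers of dimension n are modelled by 'M[R[i]]_n; composite      *)
(* registers A B by the Kronecker product *t (index (a,b) = a*dB + b). *)

Definition adjmx {R : rcfType} {m n : nat} (A : 'M[R[i]]_(m, n)) : 'M[R[i]]_(n, m) :=
  (map_mx (@conjc R) A)^T.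

Definition unitarymx {R : rcfType} {n : nat} (U : 'M[R[i]]_n) : bool :=
  (adjmx U *m U == 1%:M) && (U *m adjmx U == 1%:M).

(* positive semidefinite (over C, this includes Hermitian) *)
Definition psdmx {R : rcfType} {n : nat} (A : 'M[R[i]]_n) : Prop :=
  forall v : 'cV[R[i]]_n, 0 <= (adjmx v *m A *m v) 0 0.

Definition densitymx {R : rcfType} {n : nat} (A : 'M[R[i]]_n) : Prop :=
  psdmx A /\ \tr A = 1.

Definition trnorm {R : realType} {n : nat} (A : 'M[R[i]]_n) : R :=
  sup [set @complex.Re R `|\tr (U *m A)| | U in [set U : 'M[R[i]]_n | unitarymx U]].

Definition apply_left {R : rcfType} {a b k : nat}
  (Phi : 'M[R[i]]_a -> 'M[R[i]]_b) (rho : 'M[R[i]]_(a * k)) : 'M[R[i]]_(b * k) :=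
  \sum_(i < k) \sum_(j < k)
     (Phi (\matrix_(s, t) rho (mxtens_index (s, i)) (mxtens_index (t, j)))
        *t (delta_mx i j : 'M[R[i]]_k)).

Definition apply_right {R : rcfType} {a b k : nat}
  (Phi : 'M[R[i]]_a -> 'M[R[i]]_b) (rho : 'M[R[i]]_(k * a)) : 'M[R[i]]_(k * b) :=
  \sum_(i < k) \sum_(j < k)
     ((delta_mx i j : 'M[R[i]]_k)
        *t Phi (\matrix_(s, t) rho (mxtens_index (i, s)) (mxtens_index (j, t)))).

Definition tens_map {R : rcfType} {a b : nat}
  (U : 'M[R[i]]_a -> 'M[R[i]]_a) (V : 'M[R[i]]_b -> 'M[R[i]]_b)
  (rho : 'M[R[i]]_(a * b)) : 'M[R[i]]_(a * b) :=
  apply_left U (apply_right V rho).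

Definition CPTP {R : rcfType} {a b : nat} (Phi : 'M[R[i]]_a -> 'M[R[i]]_b) : Prop :=
  [/\ (forall (c : R[i]) (A B : 'M[R[i]]_a), Phi (c *: A + B) = c *: Phi A + Phi B),
      (forall A : 'M[R[i]]_a, \tr (Phi A) = \tr A) &
      (forall (k : nat) (rho : 'M[R[i]]_(a * k)), psdmx rho -> psdmx (apply_left Phi rho))].

Definition ket {R : rcfType} {T : finType} (x : T) : 'cV[R[i]]_#|T| :=
  delta_mx (enum_rank x) 0.

Definition proj {R : rcfType} {T : finType} (x : T) : 'M[R[i]]_#|T| :=
  ket x *m adjmx (ket x).

Definition maxent {R : rcfType} (n : nat) : 'M[R[i]]_(n * n) :=
  \matrix_(i, j)
    ((n%:R)^-1 * (((mxtens_unindex i).1 == (mxtens_unindex i).2)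
                 && ((mxtens_unindex j).1 == (mxtens_unindex j).2))%:R).

Definition maxmixed {R : rcfType} (n : nat) : 'M[R[i]]_n := (n%:R)^-1 *: 1%:M.

Definition pauli1 {R : rcfType} (k : 'I_4) : 'M[R[i]]_2 :=
  match val k with
  | 0 => 1%:M
  | 1 => \matrix_(i, j) ((i != j)%:R)
  | 2 => \matrix_(i, j) ((i != j)%:R * (if i == 0 then - Complex 0 1 else Complex 0 1))
  | _ => \matrix_(i, j) ((i == j)%:R * (if i == 0 then 1 else -1))
  end.

Fixpoint pauli_str {R : rcfType} (m : nat) (s : nat -> 'I_4) : 'M[R[i]]_(2 ^ m) :=
  match m return 'M[R[i]]_(2 ^ m) with
  | 0 => 1%:M
  | m'.+1 => castmx (esym (expnS 2 m'), esym (expnS 2 m'))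
               (pauli1 (s 0) *t pauli_str m' (fun i => s i.+1))
  end.

Definition pauli_string {R : rcfType} {m : nat} (s : m.-tuple 'I_4) : 'M[R[i]]_(2 ^ m) :=
  pauli_str m (nth ord0 s).

Definition nontrivial_pauli {m : nat} (s : m.-tuple 'I_4) : bool :=
  has (fun k => k != ord0) s.

Definition pauli_group_elt {R : rcfType} {m : nat} (A : 'M[R[i]]_(2 ^ m)) : Prop :=
  exists (c : R[i]) (s : m.-tuple 'I_4),
    c \in [:: 1; -1; Complex 0 1; - Complex 0 1] /\ A = c *: pauli_string s.

Definition clifford {R : rcfType} {m : nat} (U : 'M[R[i]]_(2 ^ m)) : Prop :=
  unitarymx U /\
  forall P : 'M[R[i]]_(2 ^ m), pauli_group_elt P -> pauli_group_elt (U *m P *m adjmx U).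

(* S = image of the injective map rep : Msg -> matrices, a subgroup of the
   Clifford group containing the Pauli group *)
Definition clifford_subgroup {R : rcfType} {m : nat} {Msg : finType}
  (rep : Msg -> 'M[R[i]]_(2 ^ m)) : Prop :=
  [/\ injective rep,
      (forall a, clifford (rep a)),
      (forall a b, exists c, rep c = rep a *m rep b),
      (forall a, exists b, rep b = adjmx (rep a)) &
      (forall P, pauli_group_elt P -> exists a, rep a = P)].

Definition pauli_mixing {R : rcfType} {m : nat} {Msg : finType}
  (rep : Msg -> 'M[R[i]]_(2 ^ m)) : Prop :=
  forall s t : m.-tuple 'I_4, nontrivial_pauli s -> nontrivial_pauli t ->
    (#|[set a : Msg | `[< exists c : R[i],
          adjmx (rep a) *m pauli_string s *m rep a = c *: pauli_string t >]]|%:R : R)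
    = #|Msg|%:R / (4 ^ m - 1)%:R.

Definition distr {R : numDomainType} {T : finType} (P : T -> R) : Prop :=
  (forall t, 0 <= P t) /\ \sum_t P t = 1.

(* statistical distance, measured with the l1-norm (= ||.||_1 of the
   corresponding diagonal states) *)
Definition l1dist {R : numDomainType} {T : finType} (P Q : T -> R) : R :=
  \sum_t `|P t - Q t|.

Definition nm_code {R : numDomainType} {Msg TX TY : finType}
  (EncNM : Msg -> TX * TY -> R) (DecNM : TX -> TY -> Msg) : Prop :=
  (forall a, distr (EncNM a)) /\
  (forall a xy, 0 < EncNM a xy -> DecNM xy.1 xy.2 = a).

Definition tampered_joint {R : numDomainType} {Msg TX TY : finType}
  (EncNM : Msg -> TX * TY -> R) (DecNM : TX -> TY -> Msg)
  (f : TX -> TX) (g : TY -> TY) (a : Msg) (mx : Msg * TX) : R :=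
  \sum_(y : TY) EncNM a (mx.2, y) * (DecNM (f mx.2) (g y) == mx.1)%:R.

Definition augmented_at_X {R : numDomainType} {Msg TX TY : finType}
  (EncNM : Msg -> TX * TY -> R) (DecNM : TX -> TY -> Msg) (eps : R) : Prop :=
  forall (f : TX -> TX) (g : TY -> TY),
    exists p : R, 0 <= p <= 1 /\
    exists PX : TX -> R, distr PX /\
    exists D : Msg * TX -> R, distr D /\
    forall a : Msg,
      l1dist (tampered_joint EncNM DecNM f g a)
             (fun mx => p * ((mx.1 == a)%:R * PX mx.2) + (1 - p) * D mx) <= eps.

(* The quantum code. Register order: X (x) Z (x) Y, with shares (X,Z)  *)
(* and Y; Z has dimension 2^m like the message register M.             *)

Definition qEnc {R : rcfType} {m : nat} {Msg TX TY : finType}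
  (rep : Msg -> 'M[R[i]]_(2 ^ m)) (EncNM : Msg -> TX * TY -> R)
  (sigma : 'M[R[i]]_(2 ^ m)) : 'M[R[i]]_(#|TX| * 2 ^ m * #|TY|) :=
  \sum_(a : Msg) (#|Msg|%:R)^-1 *:
    \sum_(x : TX) \sum_(y : TY)
      (EncNM a (x, y))%:C%C *: ((proj x *t (rep a *m sigma *m adjmx (rep a))) *t proj y).

(* <x| (x) I_Z (x) <y| *)
Definition slice_xy {R : rcfType} {m : nat} {TX TY : finType} (x : TX) (y : TY)
  : 'M[R[i]]_(2 ^ m, #|TX| * 2 ^ m * #|TY|) :=
  \matrix_(i, j) ((j == mxtens_index (mxtens_index (enum_rank x, i), enum_rank y))%:R).

Definition qDec {R : rcfType} {m : nat} {Msg TX TY : finType}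
  (rep : Msg -> 'M[R[i]]_(2 ^ m)) (DecNM : TX -> TY -> Msg)
  (rho : 'M[R[i]]_(#|TX| * 2 ^ m * #|TY|)) : 'M[R[i]]_(2 ^ m) :=
  \sum_(x : TX) \sum_(y : TY)
    (adjmx (rep (DecNM x y)) *m (slice_xy x y *m rho *m adjmx (slice_xy x y))
       *m rep (DecNM x y)).

Definition qOutput {R : rcfType} {m : nat} {Msg TX TY : finType}
  (rep : Msg -> 'M[R[i]]_(2 ^ m)) (EncNM : Msg -> TX * TY -> R)
  (DecNM : TX -> TY -> Msg)
  (U : 'M[R[i]]_(#|TX| * 2 ^ m) -> 'M[R[i]]_(#|TX| * 2 ^ m))
  (V : 'M[R[i]]_#|TY| -> 'M[R[i]]_#|TY|) : 'M[R[i]]_(2 ^ m * 2 ^ m) :=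
  apply_left (qDec rep DecNM)
    (apply_left (tens_map U V) (apply_left (qEnc rep EncNM) (maxent (2 ^ m)))).

(* Main.v *)
Require Import Defs.
From HB Require Import structures.
From mathcomp Require Import all_boot all_order all_algebra.
From mathcomp Require Import boolp classical_sets reals.
From mathcomp Require Import complex mxtens.
From mathcomp Require Import ring lra.

Set Implicit Arguments.
Unset Strict Implicit.
Unset Printing Implicit Defensive.

Import Order.TTheory GRing.Theory Num.Theory.
Local Open Scope ring_scope.

(** Since X and Y are measured, [U] may be replaced by its branches [x -> x'] on Z and [V] by a
    stochastic matrix on Y. For every key [r] the register Z holds half of a maximally entangled
    state, so the probability of the branch [x -> x'] does not depend on [r]; the tampering is thus
    a mixture, independent of [r], of deterministic pairs [(f, g)], each applying to Z a completely
    positive map that depends only on [(f, x)]. Augmented non-malleability replaces the joint law of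
    [(r', x)] by the ideal one, at cost [epsNM]. Where [r'] is independent of [r], averaging over
    [r] depolarizes Z and leaves exactly [gamma (x) maxmixed]. Where [r' = r], the averaged map is
    covariant under the group, hence equal to [A |-> c A + (lam - c) tr(A) / D] with [D = 2 ^ m];
    complete positivity gives [- lam / (D ^ 2 - 1) <= c <= lam], and replacing [c] by [max c 0]
    costs at most [2 / (D ^ 2 - 1)]. *)

(** * Adjoints and positivity *)

Lemma adjmxE {R : rcfType} {m n} (A : 'M[R[i]]_(m, n)) i j :
  adjmx A i j = conjc (A j i).
Proof. by rewrite !mxE. Qed.

Lemma adjmxM {R : rcfType} {m n p} (A : 'M[R[i]]_(m, n)) (B : 'M[R[i]]_(n, p)) :
  adjmx (A *m B) = adjmx B *m adjmx A.
Proof. by rewrite /adjmx map_mxM trmx_mul. Qed.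

Lemma adjmxK {R : rcfType} {m n} (A : 'M[R[i]]_(m, n)) : adjmx (adjmx A) = A.
Proof. by apply/matrixP=> i j; rewrite !adjmxE conjcK. Qed.

Lemma adjmxD {R : rcfType} {m n} (A B : 'M[R[i]]_(m, n)) :
  adjmx (A + B) = adjmx A + adjmx B.
Proof. by apply/matrixP=> i j; rewrite adjmxE [X in conjc X]mxE rmorphD [RHS]mxE !adjmxE. Qed.

Lemma adjmxZ {R : rcfType} {m n} c (A : 'M[R[i]]_(m, n)) :
  adjmx (c *: A) = conjc c *: adjmx A.
Proof. by apply/matrixP=> i j; rewrite adjmxE [X in conjc X]mxE rmorphM [RHS]mxE adjmxE. Qed.

Lemma adjmx0 {R : rcfType} {m n} : adjmx (0 : 'M[R[i]]_(m, n)) = 0.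
Proof. by apply/matrixP=> i j; rewrite adjmxE !mxE conjc0. Qed.

Lemma adjmx1 {R : rcfType} n : adjmx (1%:M : 'M[R[i]]_n) = 1%:M.
Proof. by apply/matrixP=> i j; rewrite adjmxE !mxE eq_sym rmorph_nat. Qed.

Lemma adjmx_sum {R : rcfType} {m n} (I : finType) (A : I -> 'M[R[i]]_(m, n)) :
  adjmx (\sum_i A i) = \sum_i adjmx (A i).
Proof.
apply/matrixP=> i j; rewrite adjmxE !summxE rmorph_sum.
by apply: eq_bigr => k _; rewrite adjmxE.
Qed.

Lemma unitarymxP {R : rcfType} {n} (U : 'M[R[i]]_n) : Defs.unitarymx U ->
  adjmx U *m U = 1%:M /\ U *m adjmx U = 1%:M.
Proof. by case/andP=> /eqP-> /eqP->. Qed.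

Lemma sum_mxtens {V : nmodType} a k (F : 'I_(a * k) -> V) :
  \sum_p F p = \sum_s \sum_i F (mxtens_index (s, i)).
Proof.
rewrite pair_big (reindex (@mxtens_index a k)) //=; first by apply: eq_bigr => -[].
by exists (@mxtens_unindex a k) => p _; rewrite (mxtens_indexK, mxtens_unindexK).
Qed.

Lemma psd_conj {R : rcfType} {m n} (K : 'M[R[i]]_(m, n)) (A : 'M[R[i]]_n) :
  psdmx A -> psdmx (K *m A *m adjmx K).
Proof.
move=> psdA v; have := psdA (adjmx K *m v).
by rewrite adjmxM adjmxK !mulmxA.
Qed.

Lemma qform_delta {R : rcfType} {n} (A : 'M[R[i]]_n) (i j : 'I_n) :
  (adjmx (delta_mx i 0 : 'cV_n) *m A *m delta_mx j (0 : 'I_1)) 0 0 = A i j.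
Proof.
rewrite -colE mxE mxE (bigD1 i) //= big1 ?addr0 => [|k ki].
  by rewrite adjmxE !mxE !eqxx rmorph1 mul1r.
by rewrite adjmxE !mxE (negPf ki) mulr0n rmorph0 mul0r.
Qed.

Lemma psd_trace_ge0 {R : rcfType} {n} (A : 'M[R[i]]_n) : psdmx A -> 0 <= \tr A.
Proof. by move=> psdA; apply: sumr_ge0 => i _; rewrite -qform_delta; apply: psdA. Qed.

(* With [z = \tr (W A)], testing positivity on [W + w 1] for [w = 1] and [w = 'i]
   shows that [\tr (A W^* )] is the conjugate of [z]; [w = - z / |z|] then gives the bound. *)
Lemma psd_unitary_trace_le {R : rcfType} {n} (W A : 'M[R[i]]_n) :
  psdmx A -> Defs.unitarymx W -> `|\tr (W *m A)| <= \tr A.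
Proof.
move=> psdA /unitarymxP[WW' WW].
set z := \tr (W *m A); set z' := \tr (A *m adjmx W).
have q w : 0 <= \tr A + conjc w * z + w * z' + w * conjc w * \tr A.
  have := psd_trace_ge0 (psd_conj (W + w%:M) psdA).
  rewrite adjmxD -[adjmx w%:M]scale1r -scalemx1 adjmxZ adjmx1 scale1r.
  rewrite !mulmxDl !mulmxDr !mxtraceD -!scalemxAl -!scalemxAr !mul1mx !mulmx1.
  rewrite !mxtraceZ mxtrace_mulC mulmxA WW' mul1mx -/z -/z' addrA.
  by rewrite !mulrA.
have tr0 := psd_trace_ge0 psdA.
have zz' : z' = conjc z.
  have := ger0_Im (q 1); have := ger0_Im (q 'i%C); have := ger0_Im tr0.
  case: (z) => a b; case: (z') => c d; case: (\tr A) => t u /= -> h1 h2.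
  by apply/eqP; rewrite eq_complex /=; apply/andP; split; apply/eqP; lra.
have [->|z0] := eqVneq z 0; first by rewrite normr0.
have := q (- z / `|z|).
have nz : conjc `|z| = `|z| by rewrite normc_def conjc_real.
have n0 : `|z| != 0 by rewrite normr_eq0.
have zc : z * conjc z = `|z| ^+ 2 by rewrite normcE sqr_sqrtc.
have -> : conjc (- z / `|z|) = - conjc z / `|z|.
  by rewrite rmorphM rmorphN fmorphV; congr (_ / _).
rewrite zz'.
have -> : - conjc z / `|z| * z = - `|z|.
  by rewrite mulrAC mulNr [conjc z * z]mulrC zc expr2 mulNr mulfK.
have -> : - z / `|z| * conjc z = - `|z| by rewrite mulrAC mulNr zc expr2 mulNr mulfK.
have -> : - z / `|z| * (- conjc z / `|z|) = 1.
  by rewrite mulrACA mulrNN zc expr2 -mulrA [X in _ * X]mulrA divff // mul1r divff.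
rewrite mul1r => h.
have : 0 <= (\tr A - `|z|) *+ 2 by rewrite mulr2n; move: h; congr (0 <= _); ring.
by rewrite pmulrn_lge0 // subr_ge0.
Qed.

(** * Choi matrices of completely positive maps *)

(** Blocks are indexed by the second tensor factor, on which [apply_left] is trivial. Hence
    [apply_left Phi] acts block by block, and identities between bipartite operators are checked one
    block at a time. *)
Definition subblock {R : rcfType} {a k} (rho : 'M[R[i]]_(a * k)) (i j : 'I_k) :
  'M[R[i]]_a := \matrix_(s, t) rho (mxtens_index (s, i)) (mxtens_index (t, j)).

Lemma subblock_inj {R : rcfType} {a k} (A B : 'M[R[i]]_(a * k)) :
  (forall i j, subblock A i j = subblock B i j) -> A = B.
Proof.
move=> AB; apply/matrixP=> p q.
case: (mxtens_indexP p) => s i; case: (mxtens_indexP q) => t j.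
by have /matrixP/(_ s t) := AB i j; rewrite !mxE.
Qed.

Lemma subblock_tens {R : rcfType} {a k} (A : 'M[R[i]]_a) (B : 'M[R[i]]_k) i j :
  subblock (A *t B) i j = B i j *: A.
Proof. by apply/matrixP=> s t; rewrite mxE tensmxE mxE mulrC. Qed.

Lemma subblock_lin {R : rcfType} {a k} c (A B : 'M[R[i]]_(a * k)) i j :
  subblock (c *: A + B) i j = c *: subblock A i j + subblock B i j.
Proof. by apply/matrixP=> s t; rewrite !mxE. Qed.

Lemma subblockZ {R : rcfType} {a k} c (A : 'M[R[i]]_(a * k)) i j :
  subblock (c *: A) i j = c *: subblock A i j.
Proof. by apply/matrixP=> s t; rewrite !mxE. Qed.

Lemma subblock_sum {R : rcfType} {a k} (I : finType) (A : I -> 'M[R[i]]_(a * k)) i j :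
  subblock (\sum_l A l) i j = \sum_l subblock (A l) i j.
Proof.
by apply/matrixP=> s t; rewrite mxE !summxE; apply: eq_bigr => l _; rewrite mxE.
Qed.

Lemma sum_delta {V : nmodType} (I : finType) (F : I -> V) k :
  \sum_i F i *+ (i == k) = F k.
Proof.
rewrite (bigD1 k) //= eqxx mulr1n big1 ?addr0 // => i /negPf->.
by rewrite mulr0n.
Qed.

Lemma subblock_apply_left {R : rcfType} {a b k}
    (Phi : 'M[R[i]]_a -> 'M[R[i]]_b) (rho : 'M[R[i]]_(a * k)) i j :
  subblock (apply_left Phi rho) i j = Phi (subblock rho i j).
Proof.
rewrite subblock_sum -[RHS](sum_delta (fun i => Phi (subblock rho i j)) i).
apply: eq_bigr => i' _; rewrite subblock_sum.
rewrite -(sum_delta (fun j => Phi (subblock rho i' j)) j) -sumrMnl.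
apply: eq_bigr => j' _; rewrite subblock_tens mxE scaler_nat -mulrnA mulnb.
by rewrite andbC (eq_sym i) (eq_sym j).
Qed.

(** Splitting the test vector along the second factor turns positivity of a bipartite operator into
    a statement about families of vectors, the form used by [cp_map]. *)
Lemma subblock_qform {R : rcfType} {a k} (A : 'M[R[i]]_(a * k)) (v : 'cV_(a * k)) :
  (adjmx v *m A *m v) 0 0 = \sum_i \sum_j
    (adjmx (\col_s v (mxtens_index (s, i)) 0) *m subblock A i j
       *m (\col_s v (mxtens_index (s, j)) 0)) 0 0.
Proof.
rewrite mxE sum_mxtens exchange_big /= [RHS]exchange_big.
apply: eq_bigr => j _ /=.
under [RHS]eq_bigr do rewrite mxE.
rewrite exchange_big; apply: eq_bigr => t _ /=.
under [RHS]eq_bigr do rewrite [X in _ * X]mxE.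
rewrite -mulr_suml; congr (_ * _).
rewrite mxE sum_mxtens exchange_big; apply: eq_bigr => i _ /=.
rewrite mxE; apply: eq_bigr => s _.
by rewrite [adjmx _ _ _]adjmxE adjmxE !mxE.
Qed.

Definition lin_map {R : rcfType} {n k} (F : 'M[R[i]]_n -> 'M[R[i]]_k) :=
  forall c A B, F (c *: A + B) = c *: F A + F B.

Lemma lin_mapD {R : rcfType} {n k} (F : 'M[R[i]]_n -> 'M[R[i]]_k) A B :
  lin_map F -> F (A + B) = F A + F B.
Proof. by move=> linF; rewrite -[A]scale1r linF !scale1r. Qed.

Lemma lin_map0 {R : rcfType} {n k} (F : 'M[R[i]]_n -> 'M[R[i]]_k) :
  lin_map F -> F 0 = 0.
Proof.
move=> linF; apply: (addIr (F 0)).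
by rewrite -lin_mapD // !add0r.
Qed.

Lemma lin_mapZ {R : rcfType} {n k} (F : 'M[R[i]]_n -> 'M[R[i]]_k) c A :
  lin_map F -> F (c *: A) = c *: F A.
Proof. by move=> linF; rewrite -[c *: A]addr0 linF lin_map0 // addr0. Qed.

Lemma lin_map_sum {R : rcfType} {n k} (F : 'M[R[i]]_n -> 'M[R[i]]_k)
    (I : finType) (A : I -> 'M[R[i]]_n) :
  lin_map F -> F (\sum_l A l) = \sum_l F (A l).
Proof.
move=> linF; apply: (big_morph F) => [B D|]; [exact: lin_mapD|exact: lin_map0].
Qed.

(** The Choi matrix, normalised so that a trace-preserving map gives trace one. *)
Definition choi {R : rcfType} {n} (F : 'M[R[i]]_n -> 'M[R[i]]_n) :=
  apply_left F (maxent n).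

(** Choi's criterion: positivity of the block matrix with blocks [F (delta_mx i j)], written as a
    quadratic form so that no ancilla appears. *)
Definition cp_map {R : rcfType} {n k} (F : 'M[R[i]]_n -> 'M[R[i]]_k) :=
  forall v : 'I_n -> 'cV[R[i]]_k,
    0 <= \sum_i \sum_j (adjmx (v i) *m F (delta_mx i j) *m v j) 0 0.

Lemma subblock_maxent {R : rcfType} n (i j : 'I_n) :
  subblock (maxent n : 'M[R[i]]_(n * n)) i j = n%:R^-1 *: delta_mx i j.
Proof. by apply/matrixP=> s t; rewrite !mxE !mxtens_indexK. Qed.

Lemma subblock_choi {R : rcfType} n (F : 'M[R[i]]_n -> 'M[R[i]]_n) i j :
  lin_map F -> subblock (choi F) i j = n%:R^-1 *: F (delta_mx i j).
Proof. by move=> linF; rewrite subblock_apply_left subblock_maxent lin_mapZ. Qed.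

(** The weight is the trace of the Choi matrix, that is, the probability of the operation on a
    maximally mixed input. It controls every trace-norm estimate below. *)
Definition weighted_cp {R : rcfType} {n} (F : 'M[R[i]]_n -> 'M[R[i]]_n) (w : R[i]) :=
  [/\ lin_map F, cp_map F & n%:R^-1 * \tr (F 1%:M) = w].

Lemma natV_ge0 {R : rcfType} n : 0 <= n%:R^-1 :> R[i].
Proof. by rewrite invr_ge0 ler0n. Qed.

Lemma choi_psd {R : rcfType} {n} (F : 'M[R[i]]_n -> 'M[R[i]]_n) :
  lin_map F -> cp_map F -> psdmx (choi F).
Proof.
move=> linF cpF v; rewrite subblock_qform.
pose u i : 'cV_n := \col_s v (mxtens_index (s, i)) 0.
have := mulr_ge0 (natV_ge0 n) (cpF u); congr (0 <= _).
rewrite mulr_sumr; apply: eq_bigr => i _; rewrite mulr_sumr; apply: eq_bigr => j _.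
by rewrite subblock_choi // -scalemxAr -scalemxAl [RHS]mxE.
Qed.

Lemma mxtrace_subblock {R : rcfType} {a k} (A : 'M[R[i]]_(a * k)) :
  \tr A = \sum_i \tr (subblock A i i).
Proof.
rewrite /mxtrace sum_mxtens exchange_big; apply: eq_bigr => i _.
by apply: eq_bigr => s _; rewrite mxE.
Qed.

Lemma sum_delta_mx {R : rcfType} n : \sum_(i < n) delta_mx i i = 1%:M :> 'M[R[i]]_n.
Proof.
apply/matrixP=> s t; rewrite summxE mxE.
rewrite -(sum_delta (fun i => (i == t)%:R) s); apply: eq_bigr => i _.
by rewrite mxE -mulrnA mulnb andbC (eq_sym s) (eq_sym t).
Qed.

Lemma choi_trace {R : rcfType} {n} (F : 'M[R[i]]_n -> 'M[R[i]]_n) :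
  lin_map F -> \tr (choi F) = n%:R^-1 * \tr (F 1%:M).
Proof.
move=> linF; rewrite mxtrace_subblock -sum_delta_mx lin_map_sum // raddf_sum mulr_sumr.
by apply: eq_bigr => i _; rewrite subblock_choi // mxtraceZ.
Qed.

Lemma weighted_cp_bound {R : rcfType} {n} (F : 'M[R[i]]_n -> 'M[R[i]]_n) w W :
  weighted_cp F w -> Defs.unitarymx W -> `|\tr (W *m choi F)| <= w.
Proof.
case=> linF cpF <- uW; rewrite -choi_trace //.
by apply: psd_unitary_trace_le => //; apply: choi_psd.
Qed.

Lemma weighted_cp_ge0 {R : rcfType} {n} (F : 'M[R[i]]_n -> 'M[R[i]]_n) w :
  weighted_cp F w -> 0 <= w.
Proof.
by case=> linF cpF <-; rewrite -choi_trace //; apply/psd_trace_ge0/choi_psd.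
Qed.

Lemma choi_sum {R : rcfType} {n} (I : finType) (c : I -> R[i])
    (F : I -> 'M[R[i]]_n -> 'M[R[i]]_n) :
  choi (fun A => \sum_l c l *: F l A) = \sum_l c l *: choi (F l).
Proof.
apply: subblock_inj => i j; rewrite subblock_apply_left subblock_sum.
by apply: eq_bigr => l _; rewrite subblockZ subblock_apply_left.
Qed.

Lemma eq_choi {R : rcfType} {n} (F G : 'M[R[i]]_n -> 'M[R[i]]_n) :
  F =1 G -> choi F = choi G.
Proof. by move=> FG; apply: subblock_inj => i j; rewrite !subblock_apply_left FG. Qed.

Lemma weighted_cp_sum {R : rcfType} {n} (I : finType) (c : I -> R[i])
    (F : I -> 'M[R[i]]_n -> 'M[R[i]]_n) w :
  (forall l, 0 <= c l) -> (forall l, weighted_cp (F l) (w l)) ->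
  weighted_cp (fun A => \sum_l c l *: F l A) (\sum_l c l * w l).
Proof.
move=> c0 Fw; split.
- move=> d A B /=; rewrite scaler_sumr -big_split /=; apply: eq_bigr => l _ /=.
  have [linF _ _] := Fw l.
  by rewrite linF scalerDr !scalerA mulrC.
- move=> v; pose q l i j := (adjmx (v i) *m F l (delta_mx i j) *m v j) 0 0.
  have -> : \sum_i \sum_j (adjmx (v i) *m (\sum_l c l *: F l (delta_mx i j)) *m v j) 0 0
      = \sum_l c l * \sum_i \sum_j q l i j.
    under [RHS]eq_bigr do rewrite mulr_sumr.
    rewrite [RHS]exchange_big; apply: eq_bigr => i _ /=.
    under [RHS]eq_bigr do rewrite mulr_sumr.
    rewrite [RHS]exchange_big; apply: eq_bigr => j _ /=.
    rewrite mulmx_sumr mulmx_suml summxE; apply: eq_bigr => l _.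
    by rewrite -scalemxAr -scalemxAl mxE.
  by apply: sumr_ge0 => l _; apply: mulr_ge0 => //; have [_ cpF _] := Fw l; apply: cpF.
- rewrite raddf_sum mulr_sumr; apply: eq_bigr => l _ /=.
  by have [_ _ <-] := Fw l; rewrite mxtraceZ mulrCA.
Qed.

Lemma eq_weighted_cp {R : rcfType} {n} (F G : 'M[R[i]]_n -> 'M[R[i]]_n) w :
  F =1 G -> weighted_cp F w -> weighted_cp G w.
Proof.
move=> FG [linF cpF wF]; split=> [c A B|v|]; last by rewrite -FG.
- by rewrite -!FG linF.
- have := cpF v; congr (0 <= _); apply: eq_bigr => i _; apply: eq_bigr => j _.
  by rewrite FG.
Qed.

Lemma conj_delta {R : rcfType} {n} (K : 'M[R[i]]_n) i j :
  K *m delta_mx i j *m adjmx K = \sum_k \sum_l (K k i * conjc (K l j)) *: delta_mx k l.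
Proof.
rewrite [LHS]matrix_sum_delta; apply: eq_bigr => k _; apply: eq_bigr => l _.
congr (_ *: _); rewrite -(mul_delta_mx (0 : 'I_1)) mulmxA -mulmxA -colE -rowE.
by rewrite mxE big_ord1 mxE [X in _ * X]mxE adjmxE.
Qed.

Lemma lin_map_conj {R : rcfType} {n k} (F : 'M[R[i]]_n -> 'M[R[i]]_k)
    (K : 'M[R[i]]_n) (B : 'M[R[i]]_k) :
  lin_map F -> lin_map (fun A => adjmx B *m F (K *m A *m adjmx K) *m B).
Proof.
move=> linF c A A'.
by rewrite mulmxDr mulmxDl -scalemxAr -scalemxAl linF mulmxDr mulmxDl -scalemxAr -scalemxAl.
Qed.

Lemma cp_map_conj {R : rcfType} {n k} (F : 'M[R[i]]_n -> 'M[R[i]]_k)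
    (K : 'M[R[i]]_n) (B : 'M[R[i]]_k) :
  lin_map F -> cp_map F -> cp_map (fun A => adjmx B *m F (K *m A *m adjmx K) *m B).
Proof.
(* Expanding [K *m delta_mx i j *m adjmx K] in matrix units moves the entries of [K] into the test
   vectors, so positivity of [F] is used at the family [w]. *)
move=> linF cpF v; pose w l := \sum_i conjc (K l i) *: (B *m v i).
have := cpF w; congr (0 <= _).
pose q k l i j := K k i * conjc (K l j) *
  (adjmx (v i) *m (adjmx B *m F (delta_mx k l) *m B) *m v j) 0 0.
transitivity (\sum_k \sum_l \sum_i \sum_j q k l i j).
  apply: eq_bigr => s _; apply: eq_bigr => l _.
  rewrite adjmx_sum !mulmx_suml summxE; apply: eq_bigr => i _.
  rewrite mulmx_sumr summxE; apply: eq_bigr => j _.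
  by rewrite adjmxZ adjmxM conjcK -!scalemxAl -scalemxAr scalerA mxE /q !mulmxA.
transitivity (\sum_i \sum_j \sum_k \sum_l q k l i j); last first.
  apply: eq_bigr => i _; apply: eq_bigr => j _.
  rewrite conj_delta lin_map_sum // mulmx_sumr !mulmx_suml mulmx_sumr mulmx_suml summxE.
  apply: eq_bigr => s _.
  rewrite lin_map_sum // mulmx_sumr !mulmx_suml mulmx_sumr mulmx_suml summxE.
  by apply: eq_bigr => l _; rewrite lin_mapZ // -scalemxAr -!scalemxAl -scalemxAr -scalemxAl mxE.
under eq_bigr do rewrite exchange_big.
rewrite exchange_big; apply: eq_bigr => i _ /=.
under eq_bigr do rewrite exchange_big.
by rewrite exchange_big.
Qed.

(** Unitarity of [K] fixes the identity and unitarity of [B] preserves the trace, so encrypting with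
    one key and decrypting with another leaves the weight unchanged. *)
Lemma weighted_cp_conj {R : rcfType} {n} (F : 'M[R[i]]_n -> 'M[R[i]]_n) w K B :
  Defs.unitarymx K -> Defs.unitarymx B -> weighted_cp F w ->
  weighted_cp (fun A => adjmx B *m F (K *m A *m adjmx K) *m B) w.
Proof.
move=> /unitarymxP[_ KK] /unitarymxP[_ BB] [linF cpF wF].
split; [exact: lin_map_conj|exact: cp_map_conj|].
by rewrite mulmx1 KK -mulmxA mxtrace_mulC -mulmxA BB mulmx1.
Qed.

Lemma sqr_sum_ge0 {R : rcfType} (I : finType) (z : I -> R[i]) :
  0 <= \sum_i \sum_j conjc (z i) * z j.
Proof.
have -> : \sum_i \sum_j conjc (z i) * z j = (\sum_j z j) * conjc (\sum_j z j).
  by rewrite rmorph_sum mulrC mulr_suml; apply: eq_bigr => i _; rewrite mulr_sumr.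
exact: mulcJ_ge0.
Qed.

Lemma weighted_cp_id {R : rcfType} {n} :
  (0 < n)%N -> @weighted_cp R n id 1.
Proof.
move=> n0; split=> // [v|]; last by rewrite mxtrace1 mulVf // pnatr_eq0 -lt0n.
have := sqr_sum_ge0 (fun i => v i i 0); congr (0 <= _).
apply: eq_bigr => i _; apply: eq_bigr => j _.
rewrite -(mul_delta_mx (0 : 'I_1)) mulmxA -mulmxA -colE -rowE.
by rewrite mxE big_ord1 !mxE.
Qed.

Lemma mxtrace_delta_ij {R : rcfType} n (i j : 'I_n) : \tr (delta_mx i j) = (i == j)%:R :> R[i].
Proof.
case: eqP => [->|/eqP ne]; last first.
  by apply: big1 => k _; rewrite mxE; case: eqP => // ->; rewrite (negPf ne).
by rewrite -(mul_delta_mx (0 : 'I_1)) mxtrace_mulC mul_delta_mx /mxtrace big_ord1 mxE.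
Qed.

Lemma weighted_cp_const {R : rcfType} {n} (G : 'M[R[i]]_n) :
  (0 < n)%N -> psdmx G -> weighted_cp (fun A => \tr A *: G) (\tr G).
Proof.
move=> n0 psdG; split=> [c A B|v|].
- by rewrite mxtraceD mxtraceZ scalerDl scalerA.
- apply: sumr_ge0 => i _; rewrite (bigD1 i) //= big1 ?addr0 => [|j].
    by rewrite mxtrace_delta_ij eqxx scale1r.
  by rewrite eq_sym mxtrace_delta_ij => /negPf->; rewrite scale0r mulmx0 mul0mx mxE.
- by rewrite mxtrace1 mxtraceZ mulrA mulVf ?mul1r // pnatr_eq0 -lt0n.
Qed.

(** * Pauli strings *)

Lemma pauli1_adj {R : rcfType} (k : 'I_4) : adjmx (pauli1 k) = pauli1 k :> 'M[R[i]]_2.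
Proof.
apply/matrixP=> s t; rewrite adjmxE.
case: k => -[|[|[|[|//]]]] lk; case: s => -[|[|//]] ls; case: t => -[|[|//]] lt;
  rewrite /pauli1 /= !mxE /=; apply/eqP; rewrite eq_complex /=;
  apply/andP; split; apply/eqP; ring.
Qed.

Lemma pauli1_comm {R : rcfType} (k l : 'I_4) : exists e : bool,
  pauli1 k *m pauli1 l = (-1) ^+ e *: (pauli1 l *m pauli1 k) :> 'M[R[i]]_2.
Proof.
(* Single-qubit Paulis anticommute exactly when they are distinct and neither is the identity. *)
exists [&& k != ord0, l != ord0 & k != l].
apply/matrixP=> s t.
case: k => -[|[|[|[|//]]]] lk; case: l => -[|[|[|[|//]]]] ll;
 case: s => -[|[|//]] ls; case: t => -[|[|//]] lt;
  rewrite !mxE !big_ord_recl !big_ord0 /pauli1 /= ?expr0 ?expr1 !mxE /=;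
  apply/eqP; rewrite eq_complex /=; apply/andP; split; apply/eqP; ring.
Qed.

Lemma pauli1_sqr {R : rcfType} (k : 'I_4) : pauli1 k *m pauli1 k = 1%:M :> 'M[R[i]]_2.
Proof.
apply/matrixP=> s t.
case: k => -[|[|[|[|//]]]] lk; case: s => -[|[|//]] ls; case: t => -[|[|//]] lt;
  rewrite !mxE !big_ord_recl !big_ord0 /pauli1 /= !mxE /=;
  apply/eqP; rewrite eq_complex /=; apply/andP; split; apply/eqP; ring.
Qed.

(** Entrywise form of the fact that the sum of [P *t P] over the four Paulis is twice the swap
    operator. *)
Lemma pauli1_complete {R : rcfType} (i j k l : 'I_2) :
  \sum_a pauli1 a i j * pauli1 a k l = 2 * ((i == l) && (j == k))%:R :> R[i].
Proof.
rewrite !big_ord_recl big_ord0 /pauli1 /= !mxE.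
case: i => -[|[|//]] ?; case: j => -[|[|//]] ?; case: k => -[|[|//]] ?; case: l => -[|[|//]] ? /=.
all: apply/eqP; rewrite eq_complex /=; apply/andP; split; apply/eqP; ring.
Qed.

Lemma castmx_sqM {R : rcfType} {n n'} (e : n = n') (A B : 'M[R[i]]_n) :
  castmx (e, e) A *m castmx (e, e) B = castmx (e, e) (A *m B).
Proof. by case: n' / e; rewrite !castmx_id. Qed.

Lemma castmx_sq1 {R : rcfType} {n n'} (e : n = n') :
  castmx (e, e) 1%:M = 1%:M :> 'M[R[i]]_n'.
Proof. by case: n' / e; rewrite castmx_id. Qed.

Lemma castmx_sqZ {R : rcfType} {n n'} (e : n = n') c (A : 'M[R[i]]_n) :
  castmx (e, e) (c *: A) = c *: castmx (e, e) A.
Proof. by case: n' / e; rewrite !castmx_id. Qed.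

Lemma castmx_sq_adj {R : rcfType} {n n'} (e : n = n') (A : 'M[R[i]]_n) :
  adjmx (castmx (e, e) A) = castmx (e, e) (adjmx A).
Proof. by case: n' / e; rewrite !castmx_id. Qed.

Lemma adjmx_tens {R : rcfType} {m n p q} (A : 'M[R[i]]_(m, n)) (B : 'M[R[i]]_(p, q)) :
  adjmx (A *t B) = adjmx A *t adjmx B.
Proof. by rewrite /adjmx map_mxT trmx_tens. Qed.

Lemma tensZZ {R : rcfType} {m n p q} a b (A : 'M[R[i]]_(m, n)) (B : 'M[R[i]]_(p, q)) :
  (a *: A) *t (b *: B) = (a * b) *: (A *t B).
Proof. by apply/matrixP=> i j; rewrite !mxE mulrACA. Qed.

Lemma tens11 {R : rcfType} m n : 1%:M *t 1%:M = 1%:M :> 'M[R[i]]_(m * n).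
Proof.
apply: subblock_inj => i j; rewrite subblock_tens; apply/matrixP=> s t.
rewrite !mxE (can_eq (@mxtens_indexK _ _)) xpair_eqE /= -natrM mulnb.
by rewrite andbC.
Qed.

Lemma pauli_adj {R : rcfType} m s : adjmx (pauli_str m s) = pauli_str m s :> 'M[R[i]]_(2 ^ m).
Proof.
elim: m s => [|m IHm] s; first exact: adjmx1.
by rewrite castmx_sq_adj adjmx_tens pauli1_adj IHm.
Qed.

Lemma pauli_sqr {R : rcfType} m s :
  pauli_str m s *m pauli_str m s = 1%:M :> 'M[R[i]]_(2 ^ m).
Proof.
elim: m s => [|m IHm] s; first exact: mulmx1.
by rewrite castmx_sqM tensmx_mul pauli1_sqr IHm tens11 castmx_sq1.
Qed.

Lemma pauli_comm {R : rcfType} m s t : exists e : bool,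
  pauli_str m s *m pauli_str m t = (-1) ^+ e *: (pauli_str m t *m pauli_str m s)
    :> 'M[R[i]]_(2 ^ m).
Proof.
elim: m s t => [|m IHm] s t; first by exists false; rewrite scale1r.
have [e1 h1] := pauli1_comm (R := R) (s 0) (t 0).
have [e2 h2] := IHm (fun i => s i.+1) (fun i => t i.+1).
exists (e1 (+) e2).
by rewrite !castmx_sqM !tensmx_mul h1 h2 tensZZ castmx_sqZ signr_addb.
Qed.

Lemma sum_tuple_cons {V : nmodType} (T : finType) m (F : m.+1.-tuple T -> V) :
  \sum_s F s = \sum_a \sum_s F (cons_tuple a s).
Proof.
rewrite pair_big (reindex (fun p : T * m.-tuple T => cons_tuple p.1 p.2)) //=.
exists (fun s => (thead s, behead_tuple s)) => [[a s] _|s _] /=.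
  by congr pair; apply: val_inj.
by case/tupleP: s => a s; apply: val_inj.
Qed.

(** The swap identity is multiplicative over qubits. Contracting it with a matrix in two ways yields
    both [pauli_twirl] and [pauli_expand]. *)
Lemma pauli_complete {R : rcfType} m (i j k l : 'I_(2 ^ m)) :
  \sum_(s : m.-tuple 'I_4) pauli_string s i j * pauli_string s k l
    = (2 ^ m)%:R * ((i == l) && (j == k))%:R :> R[i].
Proof.
elim: m i j k l => [|m IHm] i j k l.
  rewrite (bigD1 [tuple]) //= big1 ?addr0 => [|s /negP[]]; last by rewrite (tuple0 s).
  by rewrite /pauli_string /= !ord1 !mxE !eqxx !mulr1.
rewrite sum_tuple_cons.
have ex (x : 'I_(2 ^ m.+1)) : exists p, x = cast_ord (esym (expnS 2 m)) (mxtens_index p).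
  by exists (mxtens_unindex (cast_ord (expnS 2 m) x)); rewrite mxtens_unindexK cast_ordK.
have [[i1 i2] ->] := ex i; have [[j1 j2] ->] := ex j.
have [[k1 k2] ->] := ex k; have [[l1 l2] ->] := ex l.
rewrite !(inj_eq (@cast_ord_inj _ _ _)) !(can_eq (@mxtens_indexK _ _)) !xpair_eqE.
transitivity (\sum_a \sum_(s : m.-tuple 'I_4) (pauli1 a i1 j1 * pauli1 a k1 l1) *
    (pauli_string s i2 j2 * pauli_string s k2 l2) : R[i]).
  apply: eq_bigr => a _; apply: eq_bigr => s _.
  by rewrite /pauli_string /= !castmxE /= !esymK !cast_ordKV !tensmxE mulrACA.
under eq_bigr do rewrite -mulr_sumr.
rewrite -mulr_suml IHm pauli1_complete mulrACA; congr (_ * _).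
  by rewrite (expnS 2) natrM.
by rewrite -natrM mulnb; do 4 case: (_ == _).
Qed.

Lemma pauli_twirl {R : rcfType} m (A : 'M[R[i]]_(2 ^ m)) :
  \sum_(s : m.-tuple 'I_4) pauli_string s *m A *m pauli_string s
    = ((2 ^ m)%:R * \tr A)%:M.
Proof.
apply/matrixP=> i l; rewrite summxE !mxE.
transitivity (\sum_k \sum_j A j k *
    \sum_(s : m.-tuple 'I_4) pauli_string s i j * pauli_string s k l).
  under [RHS]eq_bigr do under eq_bigr do rewrite mulr_sumr.
  under [RHS]eq_bigr do rewrite exchange_big /=.
  rewrite exchange_big /=; apply: eq_bigr => s _; rewrite mxE; apply: eq_bigr => k _.
  by rewrite mxE mulr_suml; apply: eq_bigr => j _; rewrite mulrCA mulrA.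
under eq_bigr do under eq_bigr do rewrite pauli_complete.
transitivity ((2 ^ m)%:R * (i == l)%:R * \tr A); last by rewrite mulrAC mulr_natr.
rewrite [RHS]mulr_sumr; apply: eq_bigr => k _.
rewrite (bigD1 k) //= big1 ?addr0 => [|j /negPf jk]; last by rewrite jk andbF !mulr0.
by rewrite eqxx andbT mulrC.
Qed.

Lemma pauli_expand {R : rcfType} m (A : 'M[R[i]]_(2 ^ m)) :
  A = (2 ^ m)%:R^-1 *: \sum_(s : m.-tuple 'I_4)
        \tr (pauli_string s *m A) *: pauli_string s.
Proof.
apply/matrixP=> k l; rewrite mxE summxE.
transitivity ((2 ^ m)%:R^-1 * \sum_i \sum_j A j i *
    \sum_(s : m.-tuple 'I_4) pauli_string s i j * pauli_string s k l); last first.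
  congr (_ * _); under eq_bigr do under eq_bigr do rewrite mulr_sumr.
  under eq_bigr do rewrite exchange_big /=.
  rewrite exchange_big /=; apply: eq_bigr => s _; rewrite mxE mulr_suml; apply: eq_bigr => i _.
  by rewrite mxE mulr_suml; apply: eq_bigr => j _; ring.
under eq_bigr do under eq_bigr do rewrite pauli_complete.
rewrite (bigD1 l) //= [X in _ + X]big1 ?addr0 => [|i /negPf il].
  rewrite (bigD1 k) //= big1 ?addr0 => [|j /negPf jk]; last by rewrite jk andbF !mulr0.
  by rewrite !eqxx mulr1 mulrCA mulVf ?mulr1 // pnatr_eq0 expn_eq0.
by apply: big1 => j _; rewrite il !mulr0.
Qed.

Lemma pauli_trivial {R : rcfType} m (s : m.-tuple 'I_4) :
  ~~ nontrivial_pauli s -> pauli_string s = 1%:M :> 'M[R[i]]_(2 ^ m).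
Proof.
elim: m s => [//|m IHm] s; case/tupleP: s => a s.
rewrite /nontrivial_pauli /= negb_or negbK => /andP[/eqP-> triv].
by rewrite /pauli_string /= [pauli_str m _]IHm // tens11 castmx_sq1.
Qed.

Lemma pauli_nontrivial m (s : m.-tuple 'I_4) :
  s != [tuple of nseq m ord0] -> nontrivial_pauli s.
Proof.
apply: contraR => /hasPn triv; apply/eqP/val_inj => /=.
have /all_pred1P : all (pred1 ord0) s by apply/allP => k /triv; rewrite negbK.
by rewrite size_tuple.
Qed.

Lemma tuple_size0_eq (T : Type) m (s t : m.-tuple T) : m = 0%N -> s = t.
Proof. by case: m s t => // s t _; rewrite (tuple0 s) (tuple0 t). Qed.

Lemma dim_neq0 {R : rcfType} m : (2 ^ m)%:R != 0 :> R[i].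
Proof. by rewrite pnatr_eq0 expn_eq0. Qed.

(** * Averages over the Clifford subgroup *)

(** A case of Schur's lemma: under the hypothesis the Pauli twirl of [A] is [4 ^ m] copies of [A],
    and [4 ^ m] is the square of the dimension. *)
Lemma pauli_commutant {R : rcfType} m (A : 'M[R[i]]_(2 ^ m)) :
  (forall s : m.-tuple 'I_4, pauli_string s *m A *m pauli_string s = A) ->
  A = ((2 ^ m)%:R^-1 * \tr A)%:M.
Proof.
move=> cA; have := pauli_twirl A.
under eq_bigr do rewrite cA.
rewrite sumr_const card_tuple card_ord -[4%N]/(2 * 2)%N expnMn -scaler_nat natrM => h.
apply: (scalerI (dim_neq0 m)); apply: (scalerI (dim_neq0 m)).
by rewrite scalerA h !scale_scalar_mx mulVKf // dim_neq0.
Qed.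

Lemma pauli_in_group {R : rcfType} m (s : m.-tuple 'I_4) :
  pauli_group_elt (pauli_string s : 'M[R[i]]_(2 ^ m)).
Proof. by exists 1, s; rewrite scale1r inE eqxx. Qed.

Lemma rep_unitary {R : rcfType} {m} {Msg : finType} (rep : Msg -> 'M[R[i]]_(2 ^ m)) :
  clifford_subgroup rep -> forall a, Defs.unitarymx (rep a).
Proof. by case=> _ cl _ _ _ a; case: (cl a). Qed.

Lemma rep_pauli {R : rcfType} {m} {Msg : finType} (rep : Msg -> 'M[R[i]]_(2 ^ m)) :
  clifford_subgroup rep -> forall s : m.-tuple 'I_4, exists a, rep a = pauli_string s.
Proof. by case=> _ _ _ _ pa s; apply/pa/pauli_in_group. Qed.

(** Translation by a group element is injective on the finite set [Msg], hence a reindexing of the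
    sum. *)
Lemma rep_shiftr {R : rcfType} {m} {Msg : finType} (rep : Msg -> 'M[R[i]]_(2 ^ m))
    (V : nmodType) (F : 'M[R[i]]_(2 ^ m) -> V) b :
  clifford_subgroup rep -> \sum_a F (rep a *m rep b) = \sum_a F (rep a).
Proof.
move=> cg; have [inj _ mul _ _] := cg.
have [h hE] := choice (fun a => mul a b).
have [_ bb] := unitarymxP (rep_unitary cg b).
have h_inj : injective h.
  move=> a a' /(congr1 rep); rewrite !hE => /(congr1 (mulmx^~ (adjmx (rep b)))).
  by rewrite -!mulmxA bb !mulmx1 => /inj.
by rewrite [RHS](reindex_inj h_inj); apply: eq_bigr => a _; rewrite hE.
Qed.

Lemma rep_shiftl {R : rcfType} {m} {Msg : finType} (rep : Msg -> 'M[R[i]]_(2 ^ m))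
    (V : nmodType) (F : 'M[R[i]]_(2 ^ m) -> V) b :
  clifford_subgroup rep -> \sum_a F (rep b *m rep a) = \sum_a F (rep a).
Proof.
move=> cg; have [inj _ mul _ _] := cg.
have [h hE] := choice (mul b).
have [bb _] := unitarymxP (rep_unitary cg b).
have h_inj : injective h.
  move=> a a' /(congr1 rep); rewrite !hE => /(congr1 (mulmx (adjmx (rep b)))).
  by rewrite !mulmxA bb !mul1mx => /inj.
by rewrite [RHS](reindex_inj h_inj); apply: eq_bigr => a _; rewrite hE.
Qed.

Lemma rep_card_neq0 {R : rcfType} {m} {Msg : finType} (rep : Msg -> 'M[R[i]]_(2 ^ m)) :
  clifford_subgroup rep -> #|Msg|%:R != 0 :> R[i].
Proof.
move=> cg; have [a _] := rep_pauli cg [tuple of nseq m ord0].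
by rewrite pnatr_eq0 -lt0n; apply/card_gt0P; exists a.
Qed.

(** The average is invariant under the Paulis by left translation, hence scalar, and conjugation by
    unitaries keeps the trace. *)
Lemma rep_depolarize {R : rcfType} {m} {Msg : finType} (rep : Msg -> 'M[R[i]]_(2 ^ m)) A :
  clifford_subgroup rep ->
  #|Msg|%:R^-1 *: \sum_a rep a *m A *m adjmx (rep a) = ((2 ^ m)%:R^-1 * \tr A)%:M.
Proof.
move=> cg; set B := LHS.
have -> : \tr A = \tr B.
  rewrite mxtraceZ raddf_sum /= (eq_bigr (fun=> \tr A)) => [|a _].
    by rewrite sumr_const -[\tr A *+ _]mulr_natl mulKf // (rep_card_neq0 cg).
  by have [aa _] := unitarymxP (rep_unitary cg a); rewrite mxtrace_mulC mulmxA aa mul1mx.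
apply: pauli_commutant => s; have [b bE] := rep_pauli cg s.
rewrite -scalemxAr -scalemxAl mulmx_sumr mulmx_suml; congr (_ *: _).
rewrite -(rep_shiftl (fun U => U *m A *m adjmx U) b cg); apply: eq_bigr => a _.
by rewrite adjmxM bE /pauli_string pauli_adj !mulmxA.
Qed.

(** The prescribed count is positive, so the group acts transitively on non-identity Paulis up to a
    scalar. *)
Lemma pauli_mixing_ex {R : rcfType} {m} {Msg : finType} (rep : Msg -> 'M[R[i]]_(2 ^ m)) s t :
  clifford_subgroup rep -> pauli_mixing rep -> nontrivial_pauli s -> nontrivial_pauli t ->
  exists a c, adjmx (rep a) *m pauli_string s *m rep a = c *: pauli_string t.
Proof.
move=> cg mix s1 t1.
suff /card_gt0P[a] : (0 < #|[set a : Msg | `[< exists c : R[i],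
    adjmx (rep a) *m pauli_string s *m rep a = c *: pauli_string t >]]|)%N.
  by rewrite inE => /asboolP[c ac]; exists a, c.
(* A nontrivial string exists, so [m] is positive and the natural number [4 ^ m - 1] does not
   vanish. *)
have m0 : (0 < m)%N by case: (m) s s1 {t t1 mix cg rep} => // s; rewrite (tuple0 s).
have [a _] := rep_pauli cg s.
rewrite -(ltr0n R) mix // divr_gt0 // ltr0n; first by apply/card_gt0P; exists a.
by rewrite subn_gt0 -{1}(expn0 4) ltn_exp2l.
Qed.

(* A map commuting with conjugation by the group is diagonal in the Pauli basis,
   and transitivity on non-identity Paulis makes the diagonal constant off the identity. *)
Lemma covariant_depolarizing {R : rcfType} {m} {Msg : finType} (rep : Msg -> 'M[R[i]]_(2 ^ m))
    (T : 'M[R[i]]_(2 ^ m) -> 'M[R[i]]_(2 ^ m)) (lam := (2 ^ m)%:R^-1 * \tr (T 1%:M)) :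
  clifford_subgroup rep -> pauli_mixing rep -> lin_map T ->
  (forall a A, T (rep a *m A *m adjmx (rep a)) = rep a *m T A *m adjmx (rep a)) ->
  exists2 c, (m = 0%N -> c = lam) &
    forall A, T A = c *: A + ((lam - c) * ((2 ^ m)%:R^-1 * \tr A))%:M.
Proof.
move=> cg mix linT covT.
pose P s : 'M[R[i]]_(2 ^ m) := pauli_string s.
have Psqr s : P s *m P s = 1%:M by apply: pauli_sqr.
have covP s A : T (P s *m A *m P s) = P s *m T A *m P s.
  by have [a aE] := rep_pauli cg s; have := covT a A; rewrite aE /pauli_string pauli_adj.
pose c s := (2 ^ m)%:R^-1 * \tr (T (P s) *m P s).
have TP s : T (P s) = c s *: P s.
  suff : T (P s) *m P s = (c s)%:M.
    by move=> /(congr1 (mulmx^~ (P s))); rewrite -mulmxA Psqr mulmx1 mul_scalar_mx.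
  (* Conjugation by [P t] multiplies both [T (P s)] and [P s] by the same sign, which cancels in
     their product. *)
  apply: pauli_commutant => t; rewrite -/(P t).
  have [e ets] : exists e : bool, P t *m P s *m P t = (-1) ^+ e *: P s.
    have [e ts] := pauli_comm (R := R) m (nth ord0 t) (nth ord0 s); exists e.
    by rewrite -/(P t) [P t *m P s]ts -scalemxAl -/(P t) -mulmxA [X in _ *m X]Psqr mulmx1.
  have -> : P t *m (T (P s) *m P s) *m P t = (P t *m T (P s) *m P t) *m (P t *m P s *m P t).
    by rewrite !mulmxA -[_ *m P t *m P t]mulmxA Psqr mulmx1.
  by rewrite -covP ets (lin_mapZ _ _ linT) -scalemxAl -scalemxAr scalerA -signr_addb addbb scale1r.
have P_inj a b s : a *: P s = b *: P s -> a = b.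
  move=> /(congr1 (fun X => \tr (X *m P s))).
  rewrite -!scalemxAl Psqr !mxtraceZ mxtrace1; apply: mulIf; exact: dim_neq0.
have cst s t : nontrivial_pauli s -> nontrivial_pauli t -> c s = c t.
  move=> s1 t1; have [a [d adE]] := pauli_mixing_ex cg mix s1 t1.
  apply: (P_inj _ _ s); rewrite -TP.
  have [_ aa] := unitarymxP (rep_unitary cg a).
  (* [P s] is a multiple of a conjugate of [P t], and by covariance [T] acts on such a conjugate
     with the eigenvalue [c t]. *)
  have PsE : P s = rep a *m (d *: P t) *m adjmx (rep a).
    by rewrite -adE !mulmxA aa mul1mx -mulmxA aa mulmx1.
  rewrite {1}PsE covT (lin_mapZ _ _ linT) TP scalerA mulrC -scalerA.
  by rewrite -scalemxAr -scalemxAl -PsE.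
pose s0 := [tuple of nseq m (ord0 : 'I_4)].
have Ps0 : P s0 = 1%:M.
  apply: pauli_trivial; rewrite /nontrivial_pauli has_nseq eqxx andbF //.
have cs0 : c s0 = lam by rewrite /c Ps0 mulmx1.
(* [c0] is the common eigenvalue off the identity. For [m = 0] there is no such string, and [lam]
   serves as default. *)
have [c0 c00 c0E] : exists2 c0, (m = 0%N -> c0 = lam) & forall s, s != s0 -> c s = c0.
  case: (pickP (fun s => s != s0)) => [s1 s10|none].
    exists (c s1) => [m0|s /pauli_nontrivial ?].
      by rewrite (tuple_size0_eq s1 s0 m0) eqxx in s10.
    by apply: cst => //; apply: pauli_nontrivial.
  by exists lam => // s; rewrite none.
exists c0 => // A.
rewrite {1}(pauli_expand A) (lin_mapZ _ _ linT) (lin_map_sum _ linT).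
(* In the Pauli expansion of [T A - c0 *: A] only the identity string survives. *)
apply/eqP; rewrite addrC -subr_eq; apply/eqP.
rewrite [in c0 *: A](pauli_expand A) scalerA mulrC -scalerA -scalerBr scaler_sumr -sumrB.
rewrite (bigD1 s0) //= big1 ?addr0 => [|s /c0E sE]; last first.
  by rewrite (lin_mapZ _ _ linT) -/(P s) TP sE !scalerA mulrC subrr.
rewrite (lin_mapZ _ _ linT) -/(P s0) TP Ps0 cs0 !scalerA mul1mx -scalerBl scalerA scalemx1.
by congr _%:M; ring.
Qed.

(** * Decomposition of the tampering *)

(** The blocks are assembled into one operator on [a * k], to which complete positivity with a
    [k]-dimensional ancilla applies. *)
Lemma cp_blocks {R : rcfType} {a b k} (Phi : 'M[R[i]]_a -> 'M[R[i]]_b)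
    (B : 'I_k -> 'I_k -> 'M[R[i]]_a) :
  CPTP Phi ->
  (forall v : 'I_k -> 'cV_a, 0 <= \sum_i \sum_j (adjmx (v i) *m B i j *m v j) 0 0) ->
  forall v : 'I_k -> 'cV_b, 0 <= \sum_i \sum_j (adjmx (v i) *m Phi (B i j) *m v j) 0 0.
Proof.
move=> [_ _ cp] posB v.
pose rho : 'M[R[i]]_(a * k) := \matrix_(p, q)
  B (mxtens_unindex p).2 (mxtens_unindex q).2 (mxtens_unindex p).1 (mxtens_unindex q).1.
have rhoE i j : subblock rho i j = B i j.
  by apply/matrixP=> s t; rewrite !mxE !mxtens_indexK.
have psd_rho : psdmx rho.
  move=> u; rewrite subblock_qform.
  under eq_bigr do under eq_bigr do rewrite rhoE.
  exact: posB.
pose u : 'cV[R[i]]_(b * k) := \col_p v (mxtens_unindex p).2 (mxtens_unindex p).1 0.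
have := cp k rho psd_rho u; rewrite subblock_qform; congr (0 <= _).
have uE i : \col_s u (mxtens_index (s, i)) 0 = v i.
  by apply/matrixP=> s t; rewrite !mxE !mxtens_indexK /= !ord1.
apply: eq_bigr => i _; apply: eq_bigr => j _.
by rewrite !uE subblock_apply_left rhoE.
Qed.

Lemma projE {R : rcfType} {T : finType} (x : T) :
  proj x = delta_mx (enum_rank x) (enum_rank x) :> 'M[R[i]]__.
Proof.
rewrite /proj /ket.
have -> : adjmx (delta_mx (enum_rank x) 0) = delta_mx 0 (enum_rank x) :> 'M[R[i]]_(1, #|T|).
  by apply/matrixP=> s t; rewrite adjmxE !mxE andbC rmorph_nat.
by rewrite mul_delta_mx.
Qed.

Lemma mxtrace_tens {R : rcfType} {a b} (A : 'M[R[i]]_a) (B : 'M[R[i]]_b) :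
  \tr (A *t B) = \tr A * \tr B.
Proof.
rewrite mxtrace_subblock [in RHS]mulrC mulr_suml; apply: eq_bigr => i _.
by rewrite subblock_tens mxtraceZ.
Qed.

Lemma sum_enum_rank {V : nmodType} {T : finType} (F : 'I_#|T| -> V) :
  \sum_i F i = \sum_x F (enum_rank x).
Proof. by rewrite (reindex enum_rank) //; apply: onW_bij; apply: enum_rank_bij. Qed.

(** The unnormalised operation on Z when X enters as [x] and is measured as [x']. *)
Definition branch {R : rcfType} {n} {TX : finType}
    (U : 'M[R[i]]_(#|TX| * n) -> 'M[R[i]]_(#|TX| * n)) (x x' : TX) (A : 'M[R[i]]_n) :
  'M[R[i]]_n :=
  \matrix_(s, t) U (proj x *t A) (mxtens_index (enum_rank x', s)) (mxtens_index (enum_rank x', t)).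

(** The probability of the branch on a maximally mixed Z. Every key leaves the reduced state of Z
    maximally mixed, so this does not depend on the key. *)
Definition branch_weight {R : rcfType} {n} {TX : finType}
    (U : 'M[R[i]]_(#|TX| * n) -> 'M[R[i]]_(#|TX| * n)) (x x' : TX) : R[i] :=
  n%:R^-1 * \tr (branch U x x' 1%:M).

Definition transition {R : rcfType} {TY : finType}
    (V : 'M[R[i]]_#|TY| -> 'M[R[i]]_#|TY|) (y y' : TY) : R[i] :=
  V (proj y) (enum_rank y') (enum_rank y').

Lemma CPTP_lin {R : rcfType} {a b} (Phi : 'M[R[i]]_a -> 'M[R[i]]_b) : CPTP Phi -> lin_map Phi.
Proof. by case. Qed.

Lemma tens_lin {R : rcfType} {m n p q} (A : 'M[R[i]]_(m, n)) c (B B' : 'M[R[i]]_(p, q)) :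
  A *t (c *: B + B') = c *: (A *t B) + A *t B'.
Proof. by apply/matrixP=> i j; rewrite !mxE mulrDr mulrCA. Qed.

Lemma branch_cp {R : rcfType} {n} {TX : finType}
    (U : 'M[R[i]]_(#|TX| * n) -> 'M[R[i]]_(#|TX| * n)) x x' :
  CPTP U -> weighted_cp (branch U x x') (branch_weight U x x').
Proof.
move=> cpU; have linU := CPTP_lin cpU; split=> // [c A B|v].
  by apply/matrixP=> s t; rewrite !mxE tens_lin linU !mxE.
(* [w i] is the product of the basis vector at [x'] with [v i]; testing on it extracts the block of
   [U] that defines [branch]. *)
pose w i : 'cV[R[i]]_(#|TX| * n) := \col_p
  (((mxtens_unindex p).1 == enum_rank x')%:R * v i (mxtens_unindex p).2 0).
have := @cp_blocks _ _ _ n U (fun i j => proj x *t delta_mx i j) cpU _ w.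
have wM i j (M : 'M[R[i]]_(#|TX| * n)) : (adjmx (w i) *m M *m w j) 0 0
    = (adjmx (v i) *m (\matrix_(s, t) M (mxtens_index (enum_rank x', s))
         (mxtens_index (enum_rank x', t))) *m v j) 0 0.
  rewrite !mxE sum_mxtens (bigD1 (enum_rank x')) //= [X in _ + X]big1 ?addr0 => [|y /negPf ne].
    apply: eq_bigr => t _; rewrite [w j _ _]mxE mxtens_indexK eqxx mul1r; congr (_ * _).
    rewrite !mxE sum_mxtens (bigD1 (enum_rank x')) //= [X in _ + X]big1 ?addr0 => [|y /negPf ne].
      by apply: eq_bigr => s _; rewrite !adjmxE [w i _ _]mxE mxtens_indexK eqxx mul1r [in RHS]mxE.
    by apply: big1 => s _; rewrite adjmxE mxE mxtens_indexK ne mul0r conjc0 mul0r.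
  by apply: big1 => t _; rewrite [w j _ _]mxE mxtens_indexK ne mul0r mulr0.
under eq_bigr do under eq_bigr do rewrite wM.
(* The input blocks [proj x *t delta_mx i j] form a rank-one operator, so their quadratic form is a
   squared modulus. *)
apply=> u; have := sqr_sum_ge0 (fun i => u i (mxtens_index (enum_rank x, i)) 0).
congr (0 <= _); apply: eq_bigr => i _; apply: eq_bigr => j _.
have -> : proj x *t delta_mx i j =
    delta_mx (mxtens_index (enum_rank x, i)) (mxtens_index (enum_rank x, j)) :> 'M[R[i]]_(_ * _).
  apply: subblock_inj => k l; rewrite subblock_tens projE; apply/matrixP=> s t.
  rewrite !mxE !(can_eq (@mxtens_indexK _ _)) !xpair_eqE -natrM mulnb.
  by congr (_%:R); do 4 case: (_ == _).
rewrite -(mul_delta_mx (0 : 'I_1)) mulmxA -mulmxA -colE -rowE.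
by rewrite mxE big_ord1 mxE adjmxE mxE.
Qed.

Lemma branch_weight_sum {R : rcfType} {n} {TX : finType}
    (U : 'M[R[i]]_(#|TX| * n) -> 'M[R[i]]_(#|TX| * n)) x :
  (0 < n)%N -> CPTP U -> \sum_x' branch_weight U x x' = 1.
Proof.
move=> n0 [_ trU _]; rewrite -mulr_sumr.
suff -> : \sum_x' \tr (branch U x x' 1%:M) = n%:R by rewrite mulVf // pnatr_eq0 -lt0n.
have : \tr (U (proj x *t 1%:M)) = n%:R.
  by rewrite trU mxtrace_tens mxtrace1 projE mxtrace_delta_ij eqxx mul1r.
rewrite /mxtrace sum_mxtens sum_enum_rank => <-; apply: eq_bigr => x' _.
by apply: eq_bigr => s _; rewrite mxE.
Qed.

Lemma transition_ge0 {R : rcfType} {TY : finType}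
    (V : 'M[R[i]]_#|TY| -> 'M[R[i]]_#|TY|) y y' : CPTP V -> 0 <= transition V y y'.
Proof.
move=> cpV; rewrite /transition -qform_delta.
(* A one-dimensional ancilla gives plain positivity of [V]. *)
have := @cp_blocks _ _ _ 1 V (fun _ _ => proj y) cpV _ (fun=> delta_mx (enum_rank y') 0).
rewrite !big_ord1; apply=> v; rewrite !big_ord1 projE -(mul_delta_mx (0 : 'I_1)).
by rewrite mulmxA -mulmxA -colE -rowE mxE big_ord1 !mxE mulrC mulcJ_ge0.
Qed.

Lemma transition_sum {R : rcfType} {TY : finType}
    (V : 'M[R[i]]_#|TY| -> 'M[R[i]]_#|TY|) y : CPTP V -> \sum_y' transition V y y' = 1.
Proof.
case=> _ trV _; have trp : \tr (proj y) = 1 :> R[i] by rewrite projE mxtrace_delta_ij eqxx.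
by rewrite -[RHS]trp -trV /mxtrace sum_enum_rank.
Qed.

(** * Stochastic matrices as mixtures of deterministic functions *)

Lemma sum_ffun_marginal {K : comNzRingType} {V : lmodType K} {T : finType}
    (q : T -> T -> K) (H : T -> V) x :
  (forall z, \sum_z' q z z' = 1) ->
  \sum_(f : {ffun T -> T}) (\prod_(z | z != x) q z (f z)) *: H (f x) = \sum_x' H x'.
Proof.
move=> q1.
have cond x' : \sum_(f : {ffun T -> T}) (f x == x')%:R * \prod_(z | z != x) q z (f z) = 1.
  (* [F] replaces row [x] by the point mass at [x']; the sum over functions then factors into row
     sums, each equal to one. *)
  pose F z z' := if z == x then (z' == x')%:R else q z z'.
  transitivity (\prod_z \sum_z' F z z').
    rewrite bigA_distr_bigA; apply: eq_bigr => f _.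
    rewrite [RHS](bigD1 x) //= /F eqxx; congr (_ * _).
    by apply: eq_bigr => z /negPf->.
  apply: big1 => z _; rewrite /F; case: eqP => // _.
  rewrite (bigD1 x') //= eqxx big1 ?addr0 // => z' /negPf->.
  by [].
transitivity (\sum_(f : {ffun T -> T}) \sum_x'
    ((f x == x')%:R * \prod_(z | z != x) q z (f z)) *: H x').
  apply: eq_bigr => f _; rewrite [RHS](bigD1 (f x)) //= eqxx mul1r.
  rewrite [X in _ = _ + X]big1 ?addr0 // => x'.
  by rewrite eq_sym => /negPf->; rewrite mul0r scale0r.
by rewrite exchange_big; apply: eq_bigr => x' _ /=; rewrite -scaler_suml cond scale1r.
Qed.

Lemma sum_ffun_marginal_full {K : comNzRingType} {V : lmodType K} {T : finType}
    (q : T -> T -> K) (H : T -> V) x :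
  (forall z, \sum_z' q z z' = 1) ->
  \sum_(f : {ffun T -> T}) (\prod_z q z (f z)) *: H (f x) = \sum_x' q x x' *: H x'.
Proof.
move=> q1; rewrite -(sum_ffun_marginal (fun x' => q x x' *: H x') x q1).
by apply: eq_bigr => f _; rewrite (bigD1 x) //= scalerA mulrC.
Qed.

Lemma sum_ffun_prod {K : comNzRingType} {T : finType} (q : T -> T -> K) :
  (forall z, \sum_z' q z z' = 1) -> \sum_(f : {ffun T -> T}) \prod_z q z (f z) = 1.
Proof. by move=> q1; rewrite -bigA_distr_bigA big1. Qed.

(** * The tampered code as a map on the message register *)

Lemma qOutput_choi {R : rcfType} {m : nat} {Msg TX TY : finType}
    (rep : Msg -> 'M[R[i]]_(2 ^ m)) (EncNM : Msg -> TX * TY -> R) (DecNM : TX -> TY -> Msg)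
    (U : 'M[R[i]]_(#|TX| * 2 ^ m) -> 'M[R[i]]_(#|TX| * 2 ^ m))
    (V : 'M[R[i]]_#|TY| -> 'M[R[i]]_#|TY|) :
  qOutput rep EncNM DecNM U V
    = choi (fun A => qDec rep DecNM (tens_map U V (qEnc rep EncNM A))).
Proof. by apply: subblock_inj => i j; rewrite !subblock_apply_left. Qed.

Lemma slice_conj {R : rcfType} {m : nat} {TX TY : finType} x y
    (rho : 'M[R[i]]_(#|TX| * 2 ^ m * #|TY|)) :
  slice_xy x y *m rho *m adjmx (slice_xy x y) = \matrix_(s, t)
    rho (mxtens_index (mxtens_index (enum_rank x, s), enum_rank y))
        (mxtens_index (mxtens_index (enum_rank x, t), enum_rank y)).
Proof.
apply/matrixP=> s t; rewrite !mxE.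
set k := mxtens_index (_, _); set l := mxtens_index (_, _).
rewrite -[RHS](sum_delta (rho k) l); apply: eq_bigr => q _.
rewrite adjmxE [slice_xy _ _ _ _]mxE rmorph_nat mulr_natr; congr (_ *+ _).
rewrite mxE -[RHS](sum_delta (rho^~ q) k); apply: eq_bigr => p _.
by rewrite mxE mulrC mulr_natr.
Qed.

Lemma lin_tens_map {R : rcfType} {a b}
    (U : 'M[R[i]]_a -> 'M[R[i]]_a) (V : 'M[R[i]]_b -> 'M[R[i]]_b) :
  lin_map U -> lin_map V -> lin_map (tens_map U V).
Proof.
move=> linU linV c A B; rewrite /tens_map.
have -> : apply_right V (c *: A + B) = c *: apply_right V A + apply_right V B.
  rewrite scaler_sumr -big_split; apply: eq_bigr => i _ /=.
  rewrite scaler_sumr -big_split; apply: eq_bigr => j _ /=.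
  rewrite -tens_lin -linV; congr (_ *t V _).
  by apply/matrixP=> s t; rewrite !mxE.
apply: subblock_inj => i j.
by rewrite subblock_apply_left !subblock_lin linU !subblock_apply_left.
Qed.

Lemma tens_mapE {R : rcfType} {a b} (U : 'M[R[i]]_a -> 'M[R[i]]_a)
    (V : 'M[R[i]]_b -> 'M[R[i]]_b) A B :
  lin_map U -> lin_map V -> tens_map U V (A *t B) = U A *t V B.
Proof.
move=> linU linV; rewrite /tens_map.
have -> : apply_right V (A *t B) = A *t V B.
  rewrite [in RHS](matrix_sum_delta A); apply: subblock_inj => k l.
  rewrite subblock_tens scaler_sumr subblock_sum; apply: eq_bigr => i _.
  rewrite scaler_sumr subblock_sum; apply: eq_bigr => j _.
  have -> : \matrix_(s, t) (A *t B) (mxtens_index (i, s)) (mxtens_index (j, t)) = A i j *: B.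
    by apply/matrixP=> s t; rewrite mxE tensmxE mxE.
  by rewrite (lin_mapZ _ _ linV) subblock_tens mxE scalerA mulrC.
apply: subblock_inj => i j.
by rewrite subblock_apply_left !subblock_tens (lin_mapZ _ _ linU).
Qed.

Lemma lin_qDec {R : rcfType} {m : nat} {Msg TX TY : finType}
    (rep : Msg -> 'M[R[i]]_(2 ^ m)) (DecNM : TX -> TY -> Msg) :
  lin_map (qDec rep DecNM).
Proof.
move=> c A B; rewrite scaler_sumr -big_split; apply: eq_bigr => x _ /=.
rewrite scaler_sumr -big_split; apply: eq_bigr => y _ /=.
by rewrite !(mulmxDr, mulmxDl) -!scalemxAr -!scalemxAl -!scalemxAr -!scalemxAl.
Qed.

(** The encoding is diagonal in X and Y and the decoder measures them, so [U] enters only through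
    [branch] and [V] only through [transition]. *)
Lemma code_mapE {R : rcfType} {m : nat} {Msg TX TY : finType}
    (rep : Msg -> 'M[R[i]]_(2 ^ m)) (EncNM : Msg -> TX * TY -> R) (DecNM : TX -> TY -> Msg)
    (U : 'M[R[i]]_(#|TX| * 2 ^ m) -> 'M[R[i]]_(#|TX| * 2 ^ m))
    (V : 'M[R[i]]_#|TY| -> 'M[R[i]]_#|TY|) A :
  lin_map U -> lin_map V ->
  qDec rep DecNM (tens_map U V (qEnc rep EncNM A)) =
  \sum_a #|Msg|%:R^-1 *: \sum_x \sum_y (EncNM a (x, y))%:C%C *:
    \sum_x' \sum_y' transition V y y' *:
      (adjmx (rep (DecNM x' y')) *m branch U x x' (rep a *m A *m adjmx (rep a))
         *m rep (DecNM x' y')).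
Proof.
move=> linU linV; have linUV := lin_tens_map linU linV.
have linD := lin_qDec rep DecNM.
rewrite (lin_map_sum _ linUV) (lin_map_sum _ linD); apply: eq_bigr => a _.
rewrite (lin_mapZ _ _ linUV) (lin_mapZ _ _ linD); congr (_ *: _).
rewrite (lin_map_sum _ linUV) (lin_map_sum _ linD); apply: eq_bigr => x _.
rewrite (lin_map_sum _ linUV) (lin_map_sum _ linD); apply: eq_bigr => y _.
rewrite (lin_mapZ _ _ linUV) (lin_mapZ _ _ linD); congr (_ *: _).
rewrite tens_mapE //; apply: eq_bigr => x' _; apply: eq_bigr => y' _.
rewrite slice_conj scalemxAl scalemxAr; congr (_ *m _ *m _).
by apply/matrixP=> s t; rewrite mxE tensmxE !mxE mulrC.
Qed.

(* One deterministic choice [f] of the tampering of X, together with its effect on Z.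
   Leaving out the factor at [x] makes the branch for [x] carry the whole probability of [f]
   as its weight, without dividing by [branch_weight], which may vanish. *)
Definition det_branch {R : rcfType} {n} {TX : finType}
    (U : 'M[R[i]]_(#|TX| * n) -> 'M[R[i]]_(#|TX| * n)) (f : {ffun TX -> TX}) (x : TX)
    (A : 'M[R[i]]_n) : 'M[R[i]]_n :=
  (\prod_(z | z != x) branch_weight U z (f z)) *: branch U x (f x) A.

Definition det_prob {K : comNzRingType} {T : finType} (q : T -> T -> K) (f : {ffun T -> T}) : K :=
  \prod_z q z (f z).

Lemma weighted_cpZ {R : rcfType} {n} (F : 'M[R[i]]_n -> 'M[R[i]]_n) w c :
  0 <= c -> weighted_cp F w -> weighted_cp (fun A => c *: F A) (c * w).
Proof.
move=> c0 Fw.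
have := @weighted_cp_sum _ _ unit (fun=> c) (fun=> F) (fun=> w) (fun=> c0) (fun=> Fw).
rewrite big_const card_unit /= addr0; apply: eq_weighted_cp => A.
by rewrite big_const card_unit /= addr0.
Qed.

Lemma branch_weight_ge0 {R : rcfType} {n} {TX : finType}
    (U : 'M[R[i]]_(#|TX| * n) -> 'M[R[i]]_(#|TX| * n)) x x' :
  CPTP U -> 0 <= branch_weight U x x'.
Proof. by move=> cpU; apply: weighted_cp_ge0 (branch_cp x x' cpU). Qed.

Lemma det_branch_cp {R : rcfType} {n} {TX : finType}
    (U : 'M[R[i]]_(#|TX| * n) -> 'M[R[i]]_(#|TX| * n)) f x :
  CPTP U -> weighted_cp (det_branch U f x) (det_prob (branch_weight U) f).
Proof.
move=> cpU; rewrite /det_prob (bigD1 x) //= mulrC; apply: weighted_cpZ.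
  by apply: prodr_ge0 => z _; apply: branch_weight_ge0.
exact: branch_cp.
Qed.

(** Instead of drawing an outcome for the actual [x] and [y], whole functions [f] and [g] are drawn
    in advance. The factor of [f] at [x] stays inside [det_branch], while [g] contributes the scalar
    [det_prob]; neither law depends on the key. *)
Lemma code_map_mixture {R : rcfType} {m : nat} {Msg TX TY : finType}
    (rep : Msg -> 'M[R[i]]_(2 ^ m)) (EncNM : Msg -> TX * TY -> R) (DecNM : TX -> TY -> Msg)
    (U : 'M[R[i]]_(#|TX| * 2 ^ m) -> 'M[R[i]]_(#|TX| * 2 ^ m))
    (V : 'M[R[i]]_#|TY| -> 'M[R[i]]_#|TY|) A :
  CPTP U -> CPTP V ->
  qDec rep DecNM (tens_map U V (qEnc rep EncNM A)) =
  \sum_(f : {ffun TX -> TX}) \sum_(g : {ffun TY -> TY}) \sum_a \sum_r \sum_x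
    (det_prob (transition V) g * #|Msg|%:R^-1
       * (tampered_joint EncNM DecNM f g a (r, x))%:C%C) *:
    (adjmx (rep r) *m det_branch U f x (rep a *m A *m adjmx (rep a)) *m rep r).
Proof.
move=> cpU cpV; rewrite code_mapE; [|exact: CPTP_lin..].
have n0 : (0 < 2 ^ m)%N by rewrite expn_gt0.
pose H a f x r := adjmx (rep r) *m det_branch U f x (rep a *m A *m adjmx (rep a)) *m rep r.
transitivity (\sum_a \sum_x \sum_y \sum_(f : {ffun TX -> TX}) \sum_(g : {ffun TY -> TY})
   (det_prob (transition V) g * #|Msg|%:R^-1 * (EncNM a (x, y))%:C%C) *:
      H a f x (DecNM (f x) (g y))).
  apply: eq_bigr => a _; rewrite scaler_sumr; apply: eq_bigr => x _.
  rewrite scaler_sumr; apply: eq_bigr => y _.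
  rewrite -(sum_ffun_marginal _ x (fun z => branch_weight_sum z n0 cpU)).
  rewrite !scaler_sumr; apply: eq_bigr => f _.
  pose K y' := adjmx (rep (DecNM (f x) y')) *m branch U x (f x) (rep a *m A *m adjmx (rep a))
     *m rep (DecNM (f x) y').
  rewrite -(sum_ffun_marginal_full K y (fun z => transition_sum z cpV)).
  rewrite !scaler_sumr; apply: eq_bigr => g _.
  rewrite /H /det_branch /K -scalemxAr -scalemxAl !scalerA; congr (_ *: _).
  by rewrite /det_prob; ring.
under eq_bigr do under eq_bigr do rewrite exchange_big /=.
under eq_bigr do rewrite exchange_big /=.
rewrite exchange_big; apply: eq_bigr => f _ /=.
under eq_bigr do under eq_bigr do rewrite exchange_big /=.
under eq_bigr do rewrite exchange_big /=.
rewrite exchange_big; apply: eq_bigr => g _ /=.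
apply: eq_bigr => a _; rewrite [RHS]exchange_big; apply: eq_bigr => x _ /=.
(* For fixed [x] and [y] the sum over [r] collapses to the decoded message [DecNM (f x) (g y)]. *)
under [RHS]eq_bigr do rewrite /tampered_joint rmorph_sum mulr_sumr scaler_suml /=.
rewrite [RHS]exchange_big; apply: eq_bigr => y _ /=.
rewrite (bigD1 (DecNM (f x) (g y))) //= big1 ?addr0 => [|r /negPf].
  by rewrite eqxx mulr1.
by rewrite eq_sym => ->; rewrite mulr0 rmorph0 mulr0 scale0r.
Qed.

(** * The twirled map *)

Lemma psdD {R : rcfType} {n} (A B : 'M[R[i]]_n) : psdmx A -> psdmx B -> psdmx (A + B).
Proof. by move=> pA pB v; rewrite mulmxDr mulmxDl mxE addr_ge0. Qed.

Lemma psdZ {R : rcfType} {n} c (A : 'M[R[i]]_n) : 0 <= c -> psdmx A -> psdmx (c *: A).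
Proof. by move=> c0 pA v; rewrite -scalemxAr -scalemxAl mxE mulr_ge0. Qed.

Lemma psd1 {R : rcfType} {n} : psdmx (1%:M : 'M[R[i]]_n).
Proof.
move=> v; rewrite mulmx1 mxE; apply: sumr_ge0 => i _.
by rewrite adjmxE mulrC mulcJ_ge0.
Qed.

Lemma psd_trace0 {R : rcfType} {n} (A : 'M[R[i]]_n) : psdmx A -> \tr A = 0 -> A = 0.
Proof.
move=> psdA trA; apply/matrixP=> i j; rewrite mxE.
have A0 k : A k k = 0.
  have ge0 l : 0 <= A l l by rewrite -qform_delta; apply: psdA.
  by have /eqP := trA; rewrite psumr_eq0 // => /allP/(_ k) /= /(_ (mem_index_enum _))/eqP.
have entryD (M N : 'M[R[i]]_1) : (M + N) 0 0 = M 0 0 + N 0 0 by rewrite mxE.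
have entryZ c (M : 'M[R[i]]_1) : (c *: M) 0 0 = c * M 0 0 by rewrite mxE.
(* With zero diagonal the form on [e_i + w e_j] is real-linear in [w], so opposite values of [w]
   force it to vanish; [w = 1] and [w = 'i] then determine both entries. *)
have q w : 0 <= w * A i j + conjc w * A j i.
  have := psdA (delta_mx i 0 + w *: delta_mx j 0).
  rewrite adjmxD adjmxZ !mulmxDl !mulmxDr -!scalemxAl -!scalemxAr.
  rewrite !entryD !entryZ !qform_delta !A0.
  by congr (0 <= _); ring.
have := q 1; have := q (-1); have := q 'i%C; have := q (- 'i%C).
case: (A i j) => a b; case: (A j i) => c d; rewrite !lecE /=.
move=> /andP[/eqP h1 h2] /andP[/eqP h3 h4] /andP[/eqP h5 h6] /andP[/eqP h7 h8].
by apply/eqP; rewrite eq_complex /=; apply/andP; split; apply/eqP; lra.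
Qed.

Lemma density_maxmixed {R : rcfType} n : (0 < n)%N -> densitymx (maxmixed n : 'M[R[i]]_n).
Proof.
move=> n0; split; first by apply: psdZ; [exact: natV_ge0|exact: psd1].
by rewrite mxtraceZ mxtrace1 mulVf // pnatr_eq0 -lt0n.
Qed.

Lemma psd_scaled_density {R : rcfType} n (A : 'M[R[i]]_n) :
  (0 < n)%N -> psdmx A -> exists2 gamma, densitymx gamma & A = \tr A *: gamma.
Proof.
move=> n0 psdA; have [tr0|trn0] := eqVneq (\tr A) 0.
  by exists (maxmixed n); [exact: density_maxmixed|rewrite tr0 scale0r; exact: psd_trace0].
exists ((\tr A)^-1 *: A); last by rewrite scalerA mulfV // scale1r.
split; first by apply: psdZ => //; rewrite invr_ge0 psd_trace_ge0.
by rewrite mxtraceZ mulVf.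
Qed.

(** The image of the maximally mixed state is a subnormalised state; it supplies the part of [gamma]
    coming from replaced messages. *)
Lemma weighted_cp_image1 {R : rcfType} {n} (F : 'M[R[i]]_n -> 'M[R[i]]_n) w :
  weighted_cp F w -> psdmx (n%:R^-1 *: F 1%:M) /\ \tr (n%:R^-1 *: F 1%:M) = w.
Proof.
case=> linF cpF <-; split; last by rewrite mxtraceZ.
apply: psdZ; first exact: natV_ge0.
move=> v; rewrite -sum_delta_mx (lin_map_sum _ linF) mulmx_sumr mulmx_suml summxE.
(* A family of test vectors supported at [l] isolates [F (delta_mx l l)]. *)
apply: sumr_ge0 => l _; have := cpF (fun i => if i == l then v else 0).
rewrite (bigD1 l) //= (bigD1 l) //= eqxx.
rewrite [X in _ + X + _]big1 => [|j /negPf->]; last by rewrite mulmx0 mxE.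
rewrite [X in _ + X]big1 ?addr0 // => i /negPf->; apply: big1 => j _.
by rewrite adjmx0 !mul0mx mxE.
Qed.

Lemma choi_trace_map {R : rcfType} n (G : 'M[R[i]]_n) :
  choi (fun A => \tr A *: G) = G *t maxmixed n.
Proof.
apply: subblock_inj => i j; rewrite subblock_apply_left subblock_maxent subblock_tens.
by rewrite mxtraceZ mxtrace_delta_ij !mxE.
Qed.

Lemma choi_id {R : rcfType} n : choi id = maxent n :> 'M[R[i]]_(n * n).
Proof. by apply: subblock_inj => i j; rewrite subblock_apply_left. Qed.

(* The two quadratic forms are the weights of a product state |0>|1> and of the
   unnormalized maximally entangled vector in the Choi matrix. *)
Lemma depolarizing_coeff_bounds {R : rcfType} m (T : 'M[R[i]]_(2 ^ m) -> 'M[R[i]]_(2 ^ m)) c lam :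
  (0 < m)%N -> cp_map T ->
  (forall A, T A = c *: A + ((lam - c) * ((2 ^ m)%:R^-1 * \tr A))%:M) ->
  c <= lam /\ 0 <= c * (2 ^ m)%:R ^+ 2 + (lam - c).
Proof.
move=> m0 cpT TE.
have D1 : (1 < 2 ^ m)%N by rewrite -{1}(expn0 2) ltn_exp2l.
have D0 : (0 < 2 ^ m)%N by rewrite expn_gt0.
have TdE i j s t : T (delta_mx i j) s t = c * ((s == i) && (t == j))%:R
     + (lam - c) * (2 ^ m)%:R^-1 * ((i == j) && (s == t))%:R.
  rewrite TE !mxE mxtrace_delta_ij; congr (_ + _).
  by rewrite -[in RHS]mulnb natrM !mulrA [RHS]mulr_natr.
split.
  have := cpT (fun i => if i == Ordinal D1 then delta_mx (Ordinal D0) 0 else 0).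
  rewrite (bigD1 (Ordinal D1)) //= (bigD1 (Ordinal D1)) //= ?eqxx.
  rewrite [X in _ + X + _]big1 => [|j /negPf->]; last by rewrite mulmx0 mxE.
  rewrite [X in _ + X]big1 ?addr0 => [|i /negPf->]; last first.
    by apply: big1 => j _; rewrite adjmx0 !mul0mx mxE.
  rewrite qform_delta TdE !eqxx /= mulr0 add0r mulr1.
  by rewrite pmulr_lge0 ?subr_ge0 // invr_gt0 ltr0n.
have := cpT (fun i => delta_mx i 0).
under eq_bigr do under eq_bigr do rewrite qform_delta TdE !eqxx /= andbb mulr1.
under eq_bigr => i _ do rewrite big_split sumr_const card_ord /= -mulr_sumr.
rewrite big_split sumr_const card_ord /= -mulr_sumr.
have -> : \sum_(i < 2 ^ m) \sum_(j < 2 ^ m) (i == j)%:R = (2 ^ m)%:R :> R[i].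
  rewrite -[in RHS](card_ord (2 ^ m)) -sumr_const; apply: eq_bigr => i _.
  by rewrite (bigD1 i) //= eqxx big1 ?addr0 // => j; rewrite eq_sym => /negPf->.
by rewrite mulfVK ?dim_neq0 // -mulrnA -[c *+ _]mulr_natr natrM.
Qed.

(** The key-averaged effect on the message when decoding recovers the original key. *)
Definition twirl {R : rcfType} {m} {Msg : finType} (rep : Msg -> 'M[R[i]]_(2 ^ m))
    (Psi : 'M[R[i]]_(2 ^ m) -> 'M[R[i]]_(2 ^ m)) (A : 'M[R[i]]_(2 ^ m)) : 'M[R[i]]_(2 ^ m) :=
  \sum_a #|Msg|%:R^-1 *: (adjmx (rep a) *m Psi (rep a *m A *m adjmx (rep a)) *m rep a).

Lemma twirl_cp {R : rcfType} {m} {Msg : finType} (rep : Msg -> 'M[R[i]]_(2 ^ m)) Psi lam :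
  clifford_subgroup rep -> weighted_cp Psi lam -> weighted_cp (twirl rep Psi) lam.
Proof.
move=> cg cpPsi; have ru := rep_unitary cg.
have -> : lam = \sum_(a : Msg) #|Msg|%:R^-1 * lam.
  by rewrite sumr_const -[RHS]mulr_natl mulrA mulfV ?mul1r // (rep_card_neq0 cg).
apply: weighted_cp_sum => a; first exact: natV_ge0.
exact: weighted_cp_conj.
Qed.

(** Right translation of the key by [b] absorbs the conjugation of the input and leaves [rep b]
    outside. *)
Lemma twirl_covariant {R : rcfType} {m} {Msg : finType} (rep : Msg -> 'M[R[i]]_(2 ^ m)) Psi b A :
  clifford_subgroup rep ->
  twirl rep Psi (rep b *m A *m adjmx (rep b)) = rep b *m twirl rep Psi A *m adjmx (rep b).
Proof.
move=> cg; have [_ bb] := unitarymxP (rep_unitary cg b).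
rewrite /twirl mulmx_sumr mulmx_suml -[RHS](rep_shiftr (fun W => rep b *m (#|Msg|%:R^-1 *:
  (adjmx W *m Psi (W *m A *m adjmx W) *m W)) *m adjmx (rep b)) b cg).
apply: eq_bigr => a _; rewrite adjmxM -scalemxAr -scalemxAl; congr (_ *: _).
by rewrite !mulmxA bb mul1mx -[_ *m rep b *m adjmx (rep b)]mulmxA bb mulmx1.
Qed.

(** The coefficient [c] may be slightly negative, hence no probability; [alpha] is its nonnegative
    part. The factor 2 anticipates the trace norm of a difference of two states. *)
Lemma twirl_depolarizing {R : rcfType} {m} {Msg : finType} (rep : Msg -> 'M[R[i]]_(2 ^ m)) Psi lam :
  clifford_subgroup rep -> pauli_mixing rep -> weighted_cp Psi lam -> lam <= 1 ->
  exists c alpha, [/\ 0 <= alpha <= lam, `|c - alpha| * 2 <= 4 / 2 ^+ m &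
    choi (twirl rep Psi)
      = c *: maxent (2 ^ m) + (lam - c) *: (maxmixed (2 ^ m) *t maxmixed (2 ^ m))].
Proof.
move=> cg mix cpPsi lam1; have cpT := twirl_cp cg cpPsi.
have [linT cpT' lamE] := cpT; have lam0 := weighted_cp_ge0 cpT.
have covT a A := twirl_covariant Psi a A cg.
have [c] := covariant_depolarizing cg mix linT covT; rewrite lamE => cm TE.
have choiE : choi (twirl rep Psi)
    = c *: maxent (2 ^ m) + (lam - c) *: (maxmixed (2 ^ m) *t maxmixed (2 ^ m)).
  apply: subblock_inj => i j; rewrite subblock_apply_left TE subblock_lin subblock_maxent.
  rewrite subblockZ subblock_tens mxtraceZ mxtrace_delta_ij; congr (_ + _).
  apply/matrixP=> s t; rewrite !mxE -[LHS]mulr_natr -[1 *+ (s == t)]/((s == t)%:R).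
  by ring.
have D0 : 0 < 2 ^+ m :> R[i] by rewrite exprn_gt0.
(* In dimension one there are no two orthogonal basis vectors to test on, but there [c = lam]
   already. *)
case: (posnP m) => [m0|m0].
  exists c, c; split=> //; last by rewrite subrr normr0 mul0r divr_ge0 // ltW.
  by rewrite cm // lam0 lexx.
have [c_le c_ge] := depolarizing_coeff_bounds m0 cpT' TE.
(* [c] is a complex scalar; it is real because [lam] and [lam - c] are nonnegative. *)
have creal : c \is Num.real.
  by rewrite -[c](subKr lam) rpredB // realE ?lam0 // subr_ge0 c_le.
have [c0|c0] := real_leP (real0 _) creal.
  exists c, c; split=> //; first by rewrite c0.
  by rewrite subrr normr0 mul0r divr_ge0 // ltW.
exists c, 0; split=> //; first by rewrite lexx lam0.
rewrite subr0 ltr0_norm // ler_pdivlMr //.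
have cD : - c * ((2 ^+ m) ^+ 2 - 1) <= 1.
  apply: le_trans lam1; rewrite -subr_ge0.
  by move: c_ge; rewrite natrX; congr (0 <= _); ring.
have D2 : 2 <= 2 ^+ m :> R[i] by rewrite -[X in X <= _]expr1 ler_eXn2l // ltr1n.
(* Writing [D] for [2 ^+ m], the bound [- c * (D ^+ 2 - 1) <= 1] reduces the claim to
   [2 * D <= 4 * (D ^+ 2 - 1)], which holds for [D >= 2]. *)
have -> : 4 = 4 * 1 :> R[i] by rewrite mulr1.
apply: le_trans (ler_wpM2l _ cD) => //.
rewrite -mulrA [leRHS]mulrCA ler_wpM2l ?oppr_ge0 ?(ltW c0) //.
rewrite -subr_ge0.
have -> : 4 * ((2 ^+ m) ^+ 2 - 1) - 2 * 2 ^+ m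
   = (2 ^+ m - 2) * (4 * 2 ^+ m + 6) + 8 :> R[i] by ring.
by rewrite addr_ge0 // mulr_ge0 ?subr_ge0 // addr_ge0 // mulr_ge0 // ltW.
Qed.

(** * Replacement of the joint distribution *)

Lemma trnorm_le {R : realType} {n} (E : 'M[R[i]]_n) (b : R) :
  (forall W, Defs.unitarymx W -> `|\tr (W *m E)| <= b%:C%C) -> trnorm E <= b.
Proof.
move=> Eb; apply: ge_sup.
  exists (complex.Re `|\tr (1%:M *m E)|), 1%:M => //.
  by rewrite /= /Defs.unitarymx adjmx1 mulmx1 eqxx.
by move=> _ [W uW <-]; have := Eb W uW; rewrite lecE => /andP[].
Qed.

Lemma mxtrace_mul_sum {R : rcfType} {n} (I : finType) (W : 'M[R[i]]_n) (c : I -> R[i]) X :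
  \tr (W *m (\sum_l c l *: X l)) = \sum_l c l * \tr (W *m X l).
Proof.
rewrite mulmx_sumr raddf_sum; apply: eq_bigr => l _.
by rewrite -scalemxAr /= mxtraceZ.
Qed.

(** Both mixtures have the same components, so only coefficients differ, and each Choi matrix
    contributes at most its weight. *)
Lemma choi_mixture_dist {R : rcfType} {n} (I : finType) (c d w : I -> R[i])
    (F : I -> 'M[R[i]]_n -> 'M[R[i]]_n) W :
  (forall l, weighted_cp (F l) (w l)) -> Defs.unitarymx W ->
  `|\tr (W *m (choi (fun A => \sum_l c l *: F l A) - choi (fun A => \sum_l d l *: F l A)))|
    <= \sum_l `|c l - d l| * w l.
Proof.
move=> Fw uW; rewrite !choi_sum mulmxBr raddfB /= !mxtrace_mul_sum -sumrB.
apply: le_trans (ler_norm_sum _ _ _) _; apply: ler_sum => l _.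
by rewrite -mulrBl normrM ler_wpM2l // weighted_cp_bound.
Qed.

(** * The output under the ideal joint law *)

Section Ideal.

Variables (R : rcfType) (m : nat) (Msg K X : finType) (rep : Msg -> 'M[R[i]]_(2 ^ m)).
(** [K] indexes deterministic tamperings. The probability of [k] is [s k * P k], where [P k] is
    carried as the weight of each [B k x]; [p], [PX] and [D] are the data of the ideal law. *)
Variables (s P p : K -> R[i]) (PX : K -> X -> R[i]) (D : K -> Msg -> X -> R[i]).
Variable B : K -> X -> 'M[R[i]]_(2 ^ m) -> 'M[R[i]]_(2 ^ m).

Definition joint_map k a r x A :=
  adjmx (rep r) *m B k x (rep a *m A *m adjmx (rep a)) *m rep r.

Definition ideal_joint k a r x := p k * ((r == a)%:R * PX k x) + (1 - p k) * D k r x.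

Definition kept_map A := \sum_l (s l.1 * p l.1 * PX l.1 l.2) *: B l.1 l.2 A.

(** The trivial conjugation by [1%:M] puts the summands in the form of [weighted_cp_conj]. *)
Definition replaced_map A := \sum_l (s l.1 * (1 - p l.1) * D l.1 l.2.1 l.2.2) *:
  (adjmx (rep l.2.1) *m B l.1 l.2.2 (1%:M *m A *m adjmx 1%:M) *m rep l.2.1).

(** In the kept part [r = a], which produces the twirl. In the replaced part the law of [r] and [x]
    is independent of [a], so the average over [a] moves inside [B] and depolarizes the input. *)
Lemma ideal_map_split A :
  clifford_subgroup rep -> (forall k x, lin_map (B k x)) ->
  \sum_k \sum_a \sum_r \sum_x
    (s k * #|Msg|%:R^-1 * ideal_joint k a r x) *: joint_map k a r x A
  = twirl rep kept_map A + \tr A *: ((2 ^ m)%:R^-1 *: replaced_map 1%:M).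
Proof.
move=> cg linB.
pose keep k a r x := (s k * #|Msg|%:R^-1 * (p k * ((r == a)%:R * PX k x))) *: joint_map k a r x A.
pose repl k a r x := (s k * #|Msg|%:R^-1 * ((1 - p k) * D k r x)) *: joint_map k a r x A.
transitivity (\sum_k \sum_a \sum_r \sum_x keep k a r x + \sum_k \sum_a \sum_r \sum_x repl k a r x).
  rewrite -big_split; apply: eq_bigr => k _ /=; rewrite -big_split; apply: eq_bigr => a _ /=.
  rewrite -big_split; apply: eq_bigr => r _ /=; rewrite -big_split; apply: eq_bigr => x _ /=.
  by rewrite -scalerDl -mulrDr.
congr (_ + _).
  rewrite exchange_big; apply: eq_bigr => a _ /=.
  rewrite mulmx_sumr mulmx_suml scaler_sumr -(pair_bigA _ (fun k x => #|Msg|%:R^-1 *: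
    (adjmx (rep a) *m ((s k * p k * PX k x) *: B k x (rep a *m A *m adjmx (rep a))) *m rep a))) /=.
  apply: eq_bigr => k _; rewrite exchange_big; apply: eq_bigr => x _ /=.
  rewrite (bigD1 a) //= big1 ?addr0 => [|r /negPf ra]; last first.
    by rewrite /keep ra mul0r !mulr0 scale0r.
  rewrite /keep eqxx mul1r /joint_map -scalemxAr -scalemxAl scalerA; congr (_ *: _); ring.
rewrite scalerA scaler_sumr -(pair_bigA _ (fun k l => (\tr A * (2 ^ m)%:R^-1) *:
  ((s k * (1 - p k) * D k l.1 l.2) *:
  (adjmx (rep l.1) *m B k l.2 (1%:M *m 1%:M *m adjmx 1%:M) *m rep l.1)))) /=.
apply: eq_bigr => k _.
rewrite -(pair_bigA _ (fun r x => (\tr A * (2 ^ m)%:R^-1) *: ((s k * (1 - p k) * D k r x) *: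
  (adjmx (rep r) *m B k x (1%:M *m 1%:M *m adjmx 1%:M) *m rep r)))) /=.
rewrite exchange_big; apply: eq_bigr => r _ /=.
rewrite exchange_big; apply: eq_bigr => x _ /=.
transitivity ((s k * (1 - p k) * D k r x) *: (adjmx (rep r) *m
   B k x (#|Msg|%:R^-1 *: \sum_a rep a *m A *m adjmx (rep a)) *m rep r)).
  rewrite (lin_mapZ _ _ (linB k x)) (lin_map_sum _ (linB k x)) -scalemxAr -scalemxAl.
  rewrite mulmx_sumr mulmx_suml scalerA scaler_sumr; apply: eq_bigr => a _.
  by rewrite /repl /joint_map; congr (_ *: _); ring.
rewrite (rep_depolarize A cg) -scalemx1 (lin_mapZ _ _ (linB k x)) adjmx1 !mulmx1.
by rewrite -scalemxAr -scalemxAl !scalerA; congr (_ *: _); ring.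
Qed.

Hypotheses (s_ge0 : forall k, 0 <= s k) (p01 : forall k, 0 <= p k <= 1).
Hypotheses (distrPX : forall k, distr (PX k)).
Hypotheses (D_ge0 : forall k r x, 0 <= D k r x) (sumD : forall k, \sum_r \sum_x D k r x = 1).
Hypotheses (cpB : forall k x, weighted_cp (B k x) (P k)) (sumP : \sum_k s k * P k = 1).

Lemma kept_map_cp : weighted_cp kept_map (\sum_k s k * P k * p k).
Proof.
have -> : \sum_k s k * P k * p k = \sum_l (s l.1 * p l.1 * PX l.1 l.2) * P l.1.
  rewrite -(pair_bigA _ (fun k x => s k * p k * PX k x * P k)) /=; apply: eq_bigr => k _.
  by rewrite -mulr_suml -mulr_sumr; have [_ ->] := distrPX k; ring.
apply: weighted_cp_sum => // -[k x] /=; have [PX0 _] := distrPX k; have /andP[p0 _] := p01 k.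
by rewrite !mulr_ge0.
Qed.

Lemma replaced_map_cp :
  clifford_subgroup rep -> weighted_cp replaced_map (\sum_k s k * P k * (1 - p k)).
Proof.
move=> cg.
have -> : \sum_k s k * P k * (1 - p k)
    = \sum_l (s l.1 * (1 - p l.1) * D l.1 l.2.1 l.2.2) * P l.1.
  rewrite -(pair_bigA _ (fun k l => s k * (1 - p k) * D k l.1 l.2 * P k)) /=.
  apply: eq_bigr => k _.
  rewrite -mulr_suml -mulr_sumr -(pair_bigA _ (fun r x => D k r x)) /= sumD; ring.
apply: weighted_cp_sum => [[k [r x]]|[k [r x]]] /=.
  by have /andP[_ p1] := p01 k; rewrite !mulr_ge0 // subr_ge0.
apply: weighted_cp_conj => //; last exact: rep_unitary.
by rewrite /Defs.unitarymx adjmx1 mulmx1 eqxx.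
Qed.

(** [alpha] comes from the depolarized kept part; everything not attributed to [maxent] is collected
    into [gamma]. *)
Lemma ideal_state : clifford_subgroup rep -> pauli_mixing rep ->
  exists alpha gamma, [/\ 0 <= alpha <= 1, densitymx gamma & forall W, Defs.unitarymx W ->
    `|\tr (W *m (choi (fun A => \sum_k \sum_a \sum_r \sum_x
          (s k * #|Msg|%:R^-1 * ideal_joint k a r x) *: joint_map k a r x A)
        - (alpha *: maxent (2 ^ m) + (1 - alpha) *: (gamma *t maxmixed (2 ^ m)))))|
      <= 4 / 2 ^+ m].
Proof.
move=> cg mix; have linB k x : lin_map (B k x) by case: (cpB k x).
have n0 : (0 < 2 ^ m)%N by rewrite expn_gt0.
set lam := \sum_k s k * P k * p k.
set mu := \sum_k s k * P k * (1 - p k).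
have lam_mu : lam + mu = 1.
  by rewrite -big_split -[RHS]sumP; apply: eq_bigr => k _ /=; ring.
have cp1 := kept_map_cp; have cp2 := replaced_map_cp cg.
have mu0 := weighted_cp_ge0 cp2.
have lam1 : lam <= 1 by rewrite -lam_mu lerDl.
have [c [alpha [/andP[a0 al] dist choiT]]] := twirl_depolarizing cg mix cp1 lam1.
have [psdG trG] := weighted_cp_image1 cp2.
set Gam := _ *: replaced_map 1%:M in psdG trG.
have [psdM trM] := @density_maxmixed R _ n0.
(* The leftover state of the output register has trace [1 - alpha]; it is positive since
   [alpha <= lam], and normalising it gives [gamma]. *)
have psdA : psdmx ((lam - alpha) *: maxmixed (2 ^ m) + Gam).
  by apply: psdD psdG; apply: psdZ psdM; rewrite subr_ge0.
have [gamma dgamma] := psd_scaled_density n0 psdA.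
rewrite mxtraceD mxtraceZ trM trG mulr1.
have -> : lam - alpha + mu = 1 - alpha by rewrite -lam_mu; ring.
move=> gammaE; exists alpha, gamma; split=> //.
  by rewrite a0 (le_trans al lam1).
move=> W uW.
have -> : choi (fun A => \sum_k \sum_a \sum_r \sum_x
    (s k * #|Msg|%:R^-1 * ideal_joint k a r x) *: joint_map k a r x A)
  = choi (twirl rep kept_map) + Gam *t maxmixed (2 ^ m).
  rewrite -choi_trace_map; apply: subblock_inj => i j.
  rewrite -[X in subblock (X + _)]scale1r subblock_lin scale1r !subblock_apply_left.
  by rewrite ideal_map_split.
have -> : (1 - alpha) *: (gamma *t maxmixed (2 ^ m))
    = (lam - alpha) *: (maxmixed (2 ^ m) *t maxmixed (2 ^ m)) + Gam *t maxmixed (2 ^ m).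
  transitivity (((1 - alpha) *: gamma) *t maxmixed (2 ^ m)).
    by apply/matrixP=> i j; rewrite !mxE mulrA.
  by rewrite -gammaE; apply: subblock_inj => i j;
    rewrite subblock_lin !subblock_tens scalerDr !scalerA [_ * (lam - _)]mulrC.
rewrite choiT.
set S := maxent _; set M := _ *t maxmixed _; set G := Gam *t _.
(* All that remains is the replacement of [c] by [alpha]. Both [S] and [M] are Choi matrices of
   weight one, which accounts for the factor 2. *)
have -> : c *: S + (lam - c) *: M + G - (alpha *: S + ((lam - alpha) *: M + G))
    = (c - alpha) *: (S - M).
  by apply/matrixP=> i j; rewrite !mxE; ring.
rewrite -scalemxAr mxtraceZ normrM; apply: le_trans dist; apply: ler_wpM2l => //.
rewrite mulmxBr raddfB; apply: le_trans (ler_normB _ _) _.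
have -> : 2 = 1 + 1 :> R[i] by ring.
apply: lerD; rewrite /=.
  by rewrite /S -choi_id; apply: weighted_cp_bound uW; apply: weighted_cp_id.
rewrite /M -choi_trace_map -[leRHS]trM.
by apply: weighted_cp_bound uW; apply: weighted_cp_const.
Qed.

End Ideal.

(** * Comparison of the actual mixture with the ideal one *)

Lemma norm_real_complex {R : rcfType} (x : R) : `|x%:C%C| = (`|x|)%:C%C :> R[i].
Proof. by rewrite normc_def /= expr0n addr0 sqrtr_sqr. Qed.

Definition mixture_map {R : rcfType} {m : nat} {Msg K X : finType}
    (rep : Msg -> 'M[R[i]]_(2 ^ m)) (s : K -> R[i])
    (B : K -> X -> 'M[R[i]]_(2 ^ m) -> 'M[R[i]]_(2 ^ m)) (H : K -> Msg -> Msg * X -> R) A :=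
  \sum_k \sum_a \sum_r \sum_x
    (s k * #|Msg|%:R^-1 * (H k a (r, x))%:C%C) *: joint_map rep B k a r x A.

(** Conjugation by keys keeps the weight [P k], so the two mixtures differ by the average of the
    distances between [J k a] and [I k a], over tamperings and a uniform key. *)
Lemma joint_replacement {R : rcfType} {m : nat} {Msg K X : finType}
    (rep : Msg -> 'M[R[i]]_(2 ^ m)) (s P : K -> R[i])
    (B : K -> X -> 'M[R[i]]_(2 ^ m) -> 'M[R[i]]_(2 ^ m))
    (J I : K -> Msg -> Msg * X -> R) (eps : R) W :
  clifford_subgroup rep -> (forall k, 0 <= s k) -> (forall k, 0 <= P k) ->
  (forall k x, weighted_cp (B k x) (P k)) -> \sum_k s k * P k = 1 ->
  (forall k a, l1dist (J k a) (I k a) <= eps) ->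
  Defs.unitarymx W ->
  `|\tr (W *m (choi (mixture_map rep s B J) - choi (mixture_map rep s B I)))| <= eps%:C%C.
Proof.
move=> cg s0 P0 cpB sumP JI uW.
pose c (H : K -> Msg -> Msg * X -> R) (l : K * (Msg * (Msg * X))) : R[i] :=
  s l.1 * #|Msg|%:R^-1 * (H l.1 l.2.1 (l.2.2.1, l.2.2.2))%:C%C.
pose F (l : K * (Msg * (Msg * X))) := joint_map rep B l.1 l.2.1 l.2.2.1 l.2.2.2.
have mixE H : mixture_map rep s B H =1 fun A => \sum_l c H l *: F l A.
  move=> A; rewrite -(pair_bigA _ (fun k l => c H (k, l) *: F (k, l) A)); apply: eq_bigr => k _.
  rewrite -(pair_bigA _ (fun a l => c H (k, (a, l)) *: F (k, (a, l)) A)); apply: eq_bigr => a _.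
  by rewrite -(pair_bigA _ (fun r x => c H (k, (a, (r, x))) *: F (k, (a, (r, x))) A)).
rewrite !(eq_choi (mixE _)).
have cpF l : weighted_cp (F l) (P l.1).
  by apply: weighted_cp_conj => //; apply: rep_unitary.
apply: le_trans (choi_mixture_dist _ _ cpF uW) _.
have N0 : 0 <= #|Msg|%:R^-1 :> R[i] := natV_ge0 _.
(* The bound is spread over the pairs of a tampering and a key, whose total probability is one. *)
have -> : eps%:C%C = \sum_k \sum_(a : Msg) s k * P k * #|Msg|%:R^-1 * eps%:C%C.
  rewrite -[LHS]mul1r -[in LHS]sumP mulr_suml; apply: eq_bigr => k _.
  rewrite -mulr_suml -mulr_sumr sumr_const; congr (_ * _).
  by rewrite -[_^-1 *+ _]mulr_natr [X in _ = _ * X](mulVf (rep_card_neq0 cg)) mulr1.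
rewrite -(pair_bigA _ (fun k l => `|c J (k, l) - c I (k, l)| * P k)) /=.
apply: ler_sum => k _.
rewrite -(pair_bigA _ (fun a l => `|c J (k, (a, l)) - c I (k, (a, l))| * P k)) /=.
apply: ler_sum => a _.
apply: le_trans (_ : s k * P k * #|Msg|%:R^-1 * (l1dist (J k a) (I k a))%:C%C <= _); last first.
  by apply: ler_wpM2l; rewrite ?mulr_ge0 ?lecR.
rewrite rmorph_sum mulr_sumr le_eqVlt; apply/orP; left; apply/eqP.
apply: eq_bigr => -[r x] _ /=.
rewrite /c /= -mulrBr -rmorphB normrM /= norm_real_complex ger0_norm ?mulr_ge0 //; ring.
Qed.

Theorem theoremB4 (R : realType) (m : nat) (Msg TX TY : finType)
  (rep : Msg -> 'M[R[i]]_(2 ^ m))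
  (EncNM : Msg -> TX * TY -> R) (DecNM : TX -> TY -> Msg) (epsNM : R) :
  clifford_subgroup rep ->
  pauli_mixing rep ->
  nm_code EncNM DecNM ->
  augmented_at_X EncNM DecNM epsNM ->
  forall (U : 'M[R[i]]_(#|TX| * 2 ^ m) -> 'M[R[i]]_(#|TX| * 2 ^ m))
         (V : 'M[R[i]]_#|TY| -> 'M[R[i]]_#|TY|),
    CPTP U -> CPTP V ->
    exists p : R, 0 <= p <= 1 /\
    exists gamma : 'M[R[i]]_(2 ^ m), densitymx gamma /\
      trnorm (qOutput rep EncNM DecNM U V
              - ((p%:C)%C *: maxent (2 ^ m) + ((1 - p)%:C)%C *: (gamma *t maxmixed (2 ^ m))))
      <= epsNM + 4 / 2 ^+ m.
Proof.
move=> cg mix _ aug U V cpU cpV.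
have n0 : (0 < 2 ^ m)%N by rewrite expn_gt0.
pose K : finType := ({ffun TX -> TX} * {ffun TY -> TY})%type.
(* Choice gathers the ideal data of all deterministic pairs into one function of [k]. *)
have /choice[t tP] : forall k : K, exists t : R * (TX -> R) * (Msg * TX -> R),
    [/\ 0 <= t.1.1 <= 1, distr t.1.2, distr t.2 & forall a,
      l1dist (tampered_joint EncNM DecNM k.1 k.2 a)
        (fun mx => t.1.1 * ((mx.1 == a)%:R * t.1.2 mx.2) + (1 - t.1.1) * t.2 mx) <= epsNM].
  move=> k; have [p [p01 [PX [dPX [D [dD le]]]]]] := aug k.1 k.2.
  by exists (p, PX, D).
(* The law of [g] enters as a scalar and the law of [f] as the weight of [B]. *)
pose s (k : K) := det_prob (transition V) k.2.
pose P (k : K) := det_prob (branch_weight U) k.1.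
pose p (k : K) : R[i] := ((t k).1.1)%:C%C.
pose PX (k : K) x : R[i] := ((t k).1.2 x)%:C%C.
pose D (k : K) r x : R[i] := ((t k).2 (r, x))%:C%C.
pose B (k : K) x := det_branch U k.1 x.
have s0 k : 0 <= s k by apply: prodr_ge0 => y _; apply: transition_ge0.
have p01 k : 0 <= p k <= 1 by have [/andP[h1 h2] _ _ _] := tP k; rewrite ler0c h1 lecR.
have dPX k : distr (PX k).
  have [_ [h1 h2] _ _] := tP k; split=> [x|]; first by rewrite ler0c.
  by rewrite -rmorph_sum h2.
have D0 k r x : 0 <= D k r x by have [_ _ [h1 h2] _] := tP k; rewrite ler0c.
have sumD k : \sum_r \sum_x D k r x = 1.
  have [_ _ [h1 h2] _] := tP k.
  by rewrite (pair_bigA _ (fun r x => D k r x)) /= -[RHS](rmorph1 (real_complex R)) -h2 rmorph_sum;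
     apply: eq_bigr => -[].
have cpB k x : weighted_cp (B k x) (P k) by apply: det_branch_cp.
have P0 k : 0 <= P k by apply: prodr_ge0 => x _; apply: branch_weight_ge0.
have sumP : \sum_k s k * P k = 1.
  rewrite -(pair_bigA _ (fun f g => s (f, g) * P (f, g))) /=.
  transitivity (\sum_(f : {ffun TX -> TX}) det_prob (branch_weight U) f).
    apply: eq_bigr => f _; rewrite /s /P /= -mulr_suml sum_ffun_prod ?mul1r // => y.
    exact: transition_sum.
  by apply: sum_ffun_prod => x; apply: branch_weight_sum.
have [alpha [gamma [/andP[a0 a1] dgamma close]]] := ideal_state s0 p01 dPX D0 sumD cpB sumP cg mix.
(* [alpha] lives in the complex field; being nonnegative, it equals its real part, which is the
   required [p]. *)
have aE : (complex.Re alpha)%:C%C = alpha by apply/RRe_real/ger0_real.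
exists (complex.Re alpha); split; first by rewrite -ler0c -lecR aE a0 a1.
exists gamma; split=> //; apply: trnorm_le => W uW.
pose J (k : K) := tampered_joint EncNM DecNM k.1 k.2.
pose I (k : K) a (mx : Msg * TX) :=
  (t k).1.1 * ((mx.1 == a)%:R * (t k).1.2 mx.2) + (1 - (t k).1.1) * (t k).2 mx.
have JI k a : l1dist (J k a) (I k a) <= epsNM by have [_ _ _] := tP k; apply.
have := joint_replacement cg s0 P0 cpB sumP JI uW.
set LJ := choi _; set LI := choi _ => near.
have -> : qOutput rep EncNM DecNM U V = LJ.
  rewrite qOutput_choi; apply: eq_choi => A; rewrite code_map_mixture //.
  by rewrite (pair_bigA _ (fun (f : {ffun TX -> TX}) (g : {ffun TY -> TY}) => \sum_a \sum_r \sum_x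
    (det_prob (transition V) g * #|Msg|%:R^-1
       * (tampered_joint EncNM DecNM f g a (r, x))%:C%C) *:
    (adjmx (rep r) *m det_branch U f x (rep a *m A *m adjmx (rep a)) *m rep r))).
have LIE : LI = choi (fun A => \sum_k \sum_a \sum_r \sum_x
          (s k * #|Msg|%:R^-1 * ideal_joint p PX D k a r x) *: joint_map rep B k a r x A).
  apply: eq_choi => A; apply: eq_bigr => k _; apply: eq_bigr => a _.
  apply: eq_bigr => r _; apply: eq_bigr => x _; congr (_ * _ *: _).
  by rewrite /I /ideal_joint rmorphD !rmorphM rmorphB rmorph1 rmorph_nat.
rewrite rmorphB rmorph1 /= aE.
(* Triangle inequality through the ideal mixture [LI]: [LJ - LI] costs [epsNM] and [LI - Y] costs
   [4 / 2 ^+ m]. *)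
set Y := _ *: maxent _ + _; have -> : LJ - Y = (LJ - LI) + (LI - Y) by rewrite addrA subrK.
rewrite mulmxDr mxtraceD; apply: le_trans (ler_normD _ _) _.
rewrite rmorphD lerD //= LIE.
have -> : (4 / 2 ^+ m)%:C%C = 4 / 2 ^+ m :> R[i] by rewrite rmorphM fmorphV rmorphXn !rmorph_nat.
exact: close.
Qed.
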